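(* Let the quantum game be two-player zero-sum, i.e. $N=2$ and $u_1=-u_2$, and suppose it admits a full-rank Nash equilibrium $X^*=(X_1^*,X_2^* )$ (each $X_i^*$ positive definite). Then for Lebesgue-almost every initial condition $Y(0)\in\mathbb H^{d_1}\times\mathbb H^{d_2}$, the FTQL trajectory $X(t)=Q(Y(t))$ is Poincaré recurrent: there exists an increasing sequence of times $t_n\to\infty$ such that $X(t_n)\to X(0)$ as $n\to\infty$.
   Context: Quantum game: players $i\in\{1,\dots,N\}$, integers $d_i\ge1$; $\mathbb H^{d}$ is the real vector space of $d\times d$ complex Hermitian matrices; $\mathcal X_i=\{X_i\in\mathbb H^{d_i}:X_i\succeq0,\operatorname{tr}X_i=1\}$, $\mathcal X=\prod_i\mathcal X_i$. Payoffs $u_i(X)=\sum_{\omega\in\Omega}U_i(\omega)\operatorname{tr}[P_\omega(X_1\otimes\cdots\otimes X_N)]$ for a finite set $\Omega$, positive semidefinite $P_\omega$ with $\sum_\omega P_\omega=I$, and real $U_i$. The payoff gradient $V_i(X)\in\mathbb H^{d_i}$ is the unique Hermitian matrix with $u_i(A;X_{-i})=\operatorname{tr}(AV_i(X))$ for all $A\in\mathbb H^{d_i}$. $X^*$ is a Nash equilibrium if $u_i(X^* )\ge u_i(X_i;X^*_{-i})$ for all $X_i\in\mathcal X_i$ and all $i$. Regularizers $h_i(X_i)=\operatorname{tr}\theta_i(X_i)$ with $\theta_i:[0,1]\to\mathbb R$ continuous, twice differentiable on $(0,1]$, $\theta_i(0)=0$, $\inf_{(0,1]}\theta_i''>0$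 (matrix functions via eigendecomposition). Mirror map $Q_i(Y_i)=\arg\max_{X_i\in\mathcal X_i}\{\operatorname{tr}(Y_iX_i)-h_i(X_i)\}$, $Q=\prod Q_i$. FTQL dynamics: $\dot Y_i=V_i(X)$, $X_i=Q_i(Y_i)$. *)

(* Defs.v *)
From HB Require Import structures.
From mathcomp Require Import all_boot all_order all_algebra.
From mathcomp Require Import all_classical all_reals all_analysis.
From mathcomp Require Import complex mxtens.

Set Implicit Arguments.
Unset Strict Implicit.
Unset Printing Implicit Defensive.

Import Order.TTheory GRing.Theory Num.Theory.
Import numFieldNormedType.Exports.
Local Open Scope ring_scope.
Local Open Scope classical_set_scope.

Section QuantumGame.
Variable R : realType.
Local Notation C := (R[i]).

Definition adjmx m n (A : 'M[C]_(m, n)) : 'M[C]_(n, m) :=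
  (map_mx (@conjc R) A)^T.

Definition hermitian d (A : 'M[C]_d) : Prop := adjmx A = A.

Definition psd d (A : 'M[C]_d) : Prop :=
  hermitian A /\ forall v : 'cV[C]_d, 0 <= complex.Re ((adjmx v *m A *m v) 0 0).

Definition pdef d (A : 'M[C]_d) : Prop :=
  hermitian A /\
  forall v : 'cV[C]_d, v != 0 -> 0 < complex.Re ((adjmx v *m A *m v) 0 0).

Definition density d (X : 'M[C]_d) : Prop := psd X /\ \tr X = 1.

Definition unitary d (U : 'M[C]_d) : Prop := U *m adjmx U = 1%:M.

Definition mxfun (theta : R -> R) d (X : 'M[C]_d) : 'M[C]_d :=
  xget 0 [set M | exists (U : 'M[C]_d) (lam : 'I_d -> R),
     [/\ unitary U,
         X = U *m diag_mx (\row_j (lam j)%:C%C) *m adjmx U &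
         M = U *m diag_mx (\row_j (theta (lam j))%:C%C) *m adjmx U]].

Definition reg (theta : R -> R) d (X : 'M[C]_d) : R := complex.Re (\tr (mxfun theta X)).

Definition admissible_theta (theta : R -> R) : Prop :=
  [/\ {within `[0, 1], continuous theta},
      theta 0 = 0,
      (forall x : R, 0 < x <= 1 -> derivable theta x 1),
      (forall x : R, 0 < x <= 1 -> derivable theta^`() x 1) &
      exists c : R, 0 < c /\ forall x : R, 0 < x <= 1 -> c <= theta^`()^`() x].

Definition mirror (theta : R -> R) d (Y : 'M[C]_d) : 'M[C]_d :=
  xget 0 [set X | density X /\
     forall X', density X' ->
       complex.Re (\tr (Y *m X')) - reg theta X' <= complex.Re (\tr (Y *m X)) - reg theta X].

Definition payoff (Om : finType) d1 d2 (U : Om -> R) (P : Om -> 'M[C]_(d1 * d2))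
  (X1 : 'M[C]_d1) (X2 : 'M[C]_d2) : R :=
  \sum_(w : Om) U w * complex.Re (\tr (P w *m (X1 *t X2))).

Definition grad1 (Om : finType) d1 d2 (U : Om -> R) (P : Om -> 'M[C]_(d1 * d2))
  (X1 : 'M[C]_d1) (X2 : 'M[C]_d2) : 'M[C]_d1 :=
  xget 0 [set M | hermitian M /\
    forall A : 'M[C]_d1, hermitian A -> payoff U P A X2 = complex.Re (\tr (A *m M))].

Definition grad2 (Om : finType) d1 d2 (U : Om -> R) (P : Om -> 'M[C]_(d1 * d2))
  (X1 : 'M[C]_d1) (X2 : 'M[C]_d2) : 'M[C]_d2 :=
  xget 0 [set M | hermitian M /\
    forall A : 'M[C]_d2, hermitian A -> payoff U P X1 A = complex.Re (\tr (A *m M))].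

Definition nash2 (Om : finType) d1 d2 (U1 U2 : Om -> R) (P : Om -> 'M[C]_(d1 * d2))
  (X1s : 'M[C]_d1) (X2s : 'M[C]_d2) : Prop :=
  [/\ density X1s, density X2s,
      (forall X1, density X1 -> payoff U1 P X1 X2s <= payoff U1 P X1s X2s) &
      (forall X2, density X2 -> payoff U2 P X1s X2 <= payoff U2 P X1s X2s)].

Definition mx_is_derive d (Y : R -> 'M[C]_d) (t : R) (D : 'M[C]_d) : Prop :=
  forall i j, is_derive t 1 (fun s => complex.Re (Y s i j)) (complex.Re (D i j)) /\
              is_derive t 1 (fun s => complex.Im (Y s i j)) (complex.Im (D i j)).

Definition mx_cont_on d (Y : R -> 'M[C]_d) (A : set R) : Prop :=
  forall i j, {within A, continuous (fun s => complex.Re (Y s i j))} /\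
              {within A, continuous (fun s => complex.Im (Y s i j))}.

Definition ftql_sol (Om : finType) d1 d2 (U1 U2 : Om -> R) (P : Om -> 'M[C]_(d1 * d2))
  (theta1 theta2 : R -> R) (Y1 : R -> 'M[C]_d1) (Y2 : R -> 'M[C]_d2) : Prop :=
  [/\ mx_cont_on Y1 `[0, +oo[, mx_cont_on Y2 `[0, +oo[ &
      forall t : R, 0 < t ->
        mx_is_derive Y1 t (grad1 U1 P (mirror theta1 (Y1 t)) (mirror theta2 (Y2 t))) /\
        mx_is_derive Y2 t (grad2 U2 P (mirror theta1 (Y1 t)) (mirror theta2 (Y2 t)))].

Definition mx_cvg d (M : nat -> 'M[C]_d) (L : 'M[C]_d) : Prop :=
  forall i j, (fun n => complex.Re (M n i j)) @ \oo --> complex.Re (L i j) /\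
              (fun n => complex.Im (M n i j)) @ \oo --> complex.Im (L i j).

Definition poincare_recurrent d1 d2 (X1 : R -> 'M[C]_d1) (X2 : R -> 'M[C]_d2) : Prop :=
  exists t : nat -> R,
    [/\ (forall n, t n < t n.+1), t @ \oo --> +oo,
        mx_cvg (fun n => X1 (t n)) (X1 0) & mx_cvg (fun n => X2 (t n)) (X2 0)].

(* linear isomorphism R^(d x d) -> H^d (real coordinates of a Hermitian matrix) *)
Definition herm_of_coords d (c : 'I_d * 'I_d -> R) : 'M[C]_d :=
  \matrix_(i, j)
    if i == j then (c (i, i))%:C%C
    else if (i < j)%N then (c (i, j) +i* c (j, i))%C
    else (c (j, i) -i* c (i, j))%C.

Definition lebesgue_null (I : finType) (A : set (I -> R)) : Prop :=
  forall eps : R, 0 < eps ->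
    exists a b : nat -> I -> R,
      [/\ (forall n i, a n i <= b n i),
          A `<=` \bigcup_n [set x | forall i, a n i <= x i <= b n i] &
          forall N, \sum_(n < N) \prod_(i : I) (b n i - a n i) <= eps].

End QuantumGame.

(* Main.v *)
(* The vector field of the dynamics has the form (y1, y2) |-> (v1(q2 y2), v2(q1 y1)),
   where the mirror maps q1, q2 are Lipschitz (strong convexity of the regularizers)
   and bounded. Subtracting from each y_i a multiple of the identity, so that one
   diagonal entry stays constant, does not change the strategies and makes the orbits
   bounded: the sum of the Fenchel couplings with the equilibrium does not increase,
   by the zero-sum and Nash conditions, and is coercive modulo the identity because
   the equilibrium has full rank.

   Poincare's recurrence argument is run on a time discretization. The symplectic
   Euler step is a composition of two shears, hence preserves volume, and follows the
   trajectories up to O(h). Let B be a small set of bounded initial conditions that do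
   not return eps-close to themselves after time N. The images of B under the scheme
   at times 0, N, ..., (m-1) N are pairwise separated and lie in a fixed box of volume
   V, so one of them is covered by boxes of total volume V / m, and so is B itself
   after undoing the shears. As m is arbitrary, B is negligible; countably many such
   sets cover all initial conditions with a non-recurrent trajectory. Neither the
   existence of the flow nor Liouville's theorem is needed. *)
Require Import Defs.
From HB Require Import structures.
From mathcomp Require Import all_boot all_order all_algebra.
From mathcomp Require Import all_classical all_reals all_analysis.
From mathcomp Require Import complex mxtens.
From mathcomp Require Import ring lra.
Import Order.TTheory GRing.Theory Num.Theory.
Import numFieldNormedType.Exports.
Local Open Scope ring_scope.
Local Open Scope classical_set_scope.
Set Implicit Arguments.
Unset Strict Implicit.
Unset Printing Implicit Defensive.

(** * Finite covers by boxes *)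

Section Boxes.
Variables (R : realType) (I : finType).
Implicit Types (p q : (I -> R) * (I -> R)) (s : seq ((I -> R) * (I -> R))).

Definition box p : set (I -> R) := [set x | forall i, p.1 i <= x i <= p.2 i].
Definition side p i := p.2 i - p.1 i.
Definition vol p := \prod_i side p i.
Definition wf_box p := forall i, p.1 i <= p.2 i.

(* The outer Jordan content of A is at most v: only finite covers are used. *)
Definition fcov (A : set (I -> R)) (v : R) :=
  exists s, [/\ forall p, p \in s -> wf_box p,
    forall x, A x -> exists2 p, p \in s & box p x & \sum_(p <- s) vol p <= v].

Lemma side_ge0 p i : wf_box p -> 0 <= side p i.
Proof. by move=> wp; rewrite /side subr_ge0; apply: wp. Qed.

Lemma vol_ge0 p : wf_box p -> 0 <= vol p.
Proof. by move=> wp; apply: prodr_ge0 => i _; apply: side_ge0. Qed.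

Lemma fcov_le A B u v : A `<=` B -> u <= v -> fcov B u -> fcov A v.
Proof.
move=> AB uv [s [ws cs ss]]; exists s; split => // [x /AB/cs//|].
exact: le_trans uv.
Qed.

Lemma fcov_cat A B u v : fcov A u -> fcov B v -> fcov (A `|` B) (u + v).
Proof.
move=> [s [ws cs ss]] [t [wt ct st]]; exists (s ++ t); split.
- by move=> p; rewrite mem_cat => /orP[/ws|/wt].
- move=> x [/cs|/ct] [p ps px]; exists p => //; rewrite mem_cat ps ?orbT //.
- by rewrite big_cat /= lerD.
Qed.

Definition halfl i p : (I -> R) * (I -> R) :=
  (p.1, fun j => if j == i then (p.1 i + p.2 i) / 2 else p.2 j).
Definition halfr i p : (I -> R) * (I -> R) :=
  (fun j => if j == i then (p.1 i + p.2 i) / 2 else p.1 j, p.2).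

Fixpoint bisect i n p : seq ((I -> R) * (I -> R)) :=
  if n is n'.+1 then bisect i n' (halfl i p) ++ bisect i n' (halfr i p)
  else [:: p].

Fixpoint bisects (r : seq I) n p : seq ((I -> R) * (I -> R)) :=
  if r is i :: r' then flatten [seq bisect i n q | q <- bisects r' n p]
  else [:: p].

(* Replacing some of the side lengths by a function of them lets the same
   subdivision argument also compute the total volume of fattened boxes. *)
Definition gvol (g : I -> R -> R) p := \prod_i g i (side p i).

Lemma side_halfl i p j : side (halfl i p) j = if j == i then side p i / 2 else side p j.
Proof. by rewrite /side /=; case: eqP => // ->; field. Qed.

Lemma side_halfr i p j : side (halfr i p) j = if j == i then side p i / 2 else side p j.
Proof. by rewrite /side /=; case: eqP => // ->; field. Qed.

Lemma gvol_half (g : I -> R -> R) i p : g i = id ->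
  gvol g (halfl i p) + gvol g (halfr i p) = gvol g p.
Proof.
move=> gi; have D q : gvol g q = side q i * \prod_(j | j != i) g j (side q j).
  by rewrite /gvol (bigD1 i) //= gi.
rewrite !D side_halfl side_halfr eqxx.
have -> : \prod_(j | j != i) g j (side (halfl i p) j) =
    \prod_(j | j != i) g j (side p j).
  by apply: eq_bigr => j /negbTE ji; rewrite side_halfl ji.
have -> : \prod_(j | j != i) g j (side (halfr i p) j) =
    \prod_(j | j != i) g j (side p j).
  by apply: eq_bigr => j /negbTE ji; rewrite side_halfr ji.
by field.
Qed.

Lemma wf_halfl i p : wf_box p -> wf_box (halfl i p).
Proof.
move=> wp j; rewrite -subr_ge0 -/(side _ j) side_halfl; case: ifP => _.
  by rewrite divr_ge0 // side_ge0.
exact: side_ge0.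
Qed.

Lemma wf_halfr i p : wf_box p -> wf_box (halfr i p).
Proof.
move=> wp j; rewrite -subr_ge0 -/(side _ j) side_halfr; case: ifP => _.
  by rewrite divr_ge0 // side_ge0.
exact: side_ge0.
Qed.

Lemma bisectP i n p : [/\
  wf_box p -> forall q, q \in bisect i n p -> wf_box q,
  forall x, box p x -> exists2 q, q \in bisect i n p & box q x,
  forall q j, q \in bisect i n p ->
    side q j = if j == i then side p i / 2 ^+ n else side p j &
  forall g, g i = id -> \sum_(q <- bisect i n p) gvol g q = gvol g p].
Proof.
elim: n p => [|n IH] p /=.
  split.
  - by move=> wp q; rewrite inE => /eqP->.
  - by move=> x px; exists p; rewrite ?inE.
  - by move=> q j; rewrite inE => /eqP->; case: eqP => // ->; rewrite expr0 divr1.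
  - by move=> g _; rewrite big_seq1.
have [wl cl sl gl] := IH (halfl i p); have [wr cr sr gr] := IH (halfr i p).
split.
- move=> wp q; rewrite mem_cat => /orP[/wl|/wr]; apply.
    exact: wf_halfl.
  exact: wf_halfr.
- move=> x px; case: (leP (x i) ((p.1 i + p.2 i) / 2)) => xm.
    have /cl[q qs qx] : box (halfl i p) x.
      move=> j /=; case: eqP => [->|_]; last exact: px.
      by rewrite xm andbT; have /andP[] := px i.
    by exists q => //; rewrite mem_cat qs.
  have /cr[q qs qx] : box (halfr i p) x.
    move=> j /=; case: eqP => [->|_]; last exact: px.
    by rewrite ltW //=; have /andP[] := px i.
  by exists q => //; rewrite mem_cat qs orbT.
- move=> q j; rewrite mem_cat => /orP[/sl|/sr]->.
    by rewrite !side_halfl eqxx; case: eqP => // _; rewrite exprS; field.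
  by rewrite !side_halfr eqxx; case: eqP => // _; rewrite exprS; field.
- by move=> g gi; rewrite big_cat /= gl // gr // gvol_half.
Qed.

(** Only the sides in [r] are cut. The other sides stay whole, so a modification [g] of them factors
    out of the sum over the pieces and the total is again a product. *)
Lemma bisectsP (r : seq I) n p : uniq r -> [/\
  wf_box p -> forall q, q \in bisects r n p -> wf_box q,
  forall x, box p x -> exists2 q, q \in bisects r n p & box q x,
  forall q j, q \in bisects r n p ->
    side q j = if j \in r then side p j / 2 ^+ n else side p j &
  forall g, (forall i, i \in r -> g i = id) ->
    \sum_(q <- bisects r n p) gvol g q = gvol g p].
Proof.
elim: r => [_|i r IH /= /andP[ir /IH[wr cr sr gr]]].
  split=> //=.
  - by move=> wp q; rewrite inE => /eqP->.
  - by move=> x px; exists p; rewrite ?inE.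
  - by move=> q j; rewrite inE => /eqP->.
  - by move=> g _; rewrite big_seq1.
split.
- move=> wp q /flatten_mapP[t tp qt].
  by have [/(_ (wr wp _ tp)) H _ _ _] := bisectP i n t; apply: H.
- move=> x /cr[t tp tx]; have [_ /(_ _ tx)[q qt qx] _ _] := bisectP i n t.
  by exists q => //; apply/flatten_mapP; exists t.
- move=> q j /flatten_mapP[t tp qt].
  have [_ _ /(_ _ j qt)-> _] := bisectP i n t.
  rewrite !(sr t) // (negbTE ir) inE; by case: eqP => [->|].
- move=> g gi; rewrite big_flatten /= big_map -gr; last first.
    by move=> j jr; apply: gi; rewrite inE jr orbT.
  apply: eq_bigr => t _; have [_ _ _ ->] := bisectP i n t => //.
  by apply: gi; rewrite inE eqxx.
Qed.

Lemma geometric_small (c d : R) : 0 < d -> exists n, c / 2 ^+ n <= d.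
Proof.
move=> d0; have [n cn] : exists n : nat, c / d <= n%:R.
  exists (Num.Def.archi_bound `|c / d|); apply: ltW.
  exact: le_lt_trans (ler_norm _) (archi_boundP (normr_ge0 _)).
exists n; rewrite ler_pdivrMr ?exprn_gt0 // mulrC -ler_pdivrMr //.
by apply: (le_trans cn); rewrite -natrX ler_nat ltnW // ltn_expl.
Qed.

(** Right continuity at d = 0 of a product of affine functions of d, by induction on the number of
    factors. *)
Lemma prod_fatten (s : seq I) (a b : I -> R) (e : R) : 0 < e ->
  (forall i, 0 <= a i) -> (forall i, 0 <= b i) ->
  exists2 d : R, 0 < d & \prod_(i <- s) (a i + b i * d) <= \prod_(i <- s) a i + e.
Proof.
move=> e0 a0 b0; elim: s e e0 => [|i s IH] e e0.
  by exists 1 => //; rewrite !big_nil lerDl ltW.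
have ai1 : 0 < a i + 1 by rewrite ltr_wpDl.
set A := \prod_(j <- s) a j.
have A0 : 0 <= A by apply: prodr_ge0.
have [d d0 dP] := IH (e / 2 / (a i + 1)) (divr_gt0 (divr_gt0 e0 (ltr0Sn R 1)) ai1).
set B := \prod_(j <- s) (a j + b j * d) in dP.
have B0 : 0 <= B by apply: prodr_ge0 => j _; rewrite addr_ge0 // mulr_ge0 // ltW.
have den : 0 < (b i + 1) * (B + 1) by rewrite mulr_gt0 // ltr_wpDl.
(* The first bound keeps the excess of the tail product, times [a i], below e / 2; the second does
   the same for the new term [b i * d' * B]. *)
pose d' := Num.min d (e / 2 / ((b i + 1) * (B + 1))).
have d'0 : 0 < d' by rewrite lt_min d0 /= divr_gt0 // divr_gt0.
have d'd : d' <= d by rewrite ge_min lexx.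
exists d' => //; rewrite !big_cons -/A.
have B'B : \prod_(j <- s) (a j + b j * d') <= B.
  apply: ler_prod => j _; rewrite addr_ge0 ?mulr_ge0 // ?(ltW d'0) //=.
  by rewrite lerD2l ler_wpM2l.
apply: (@le_trans _ _ ((a i + b i * d') * B)).
  by rewrite ler_wpM2l // addr_ge0 // mulr_ge0 // ltW.
rewrite mulrDl [e in leRHS]splitr addrA; apply: lerD.
  apply: (@le_trans _ _ (a i * (A + e / 2 / (a i + 1)))).
    by rewrite ler_wpM2l.
  rewrite mulrDr lerD2l mulrA ler_pdivrMr // mulrC ler_wpM2l ?lerDl //.
  by rewrite divr_ge0 // ltW.
have : d' <= e / 2 / ((b i + 1) * (B + 1)) by rewrite ge_min lexx orbT.
rewrite ler_pdivlMr //; apply: le_trans.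
rewrite -mulrA mulrCA; rewrite ler_wpM2l ?(ltW d'0) //.
by apply: ler_pM; rewrite ?lerDl.
Qed.

Lemma side_sum p i : wf_box p -> side p i <= \sum_j side p j.
Proof.
move=> wp; rewrite (bigD1 i) //= lerDl; apply: sumr_ge0 => j _.
exact: side_ge0.
Qed.

(* Among m sets in one box no two of which come within d of each other,
   one can be covered by a fraction 1/m of the volume. *)
Lemma fcov_pigeonhole (m : nat) (A : nat -> set (I -> R)) p (d : R) : wf_box p -> 0 < d ->
  (0 < m)%N -> (forall k, (k < m)%N -> A k `<=` box p) ->
  (forall j k u v, (j < k < m)%N -> A j u -> A k v -> ~ forall i, `|u i - v i| <= d) ->
  exists2 k, (k < m)%N & fcov (A k) (vol p / m%:R).
Proof.
move=> wp d0 m0 Ap sep.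
have [n nP] := geometric_small (\sum_j side p j) d0.
have [ws cs ss gs] := bisectsP n p (enum_uniq I).
set s := bisects _ n p in ws cs ss gs.
have sd q i : q \in s -> side q i <= d.
  move=> qs; rewrite ss // mem_enum /=; apply: le_trans nP.
  by rewrite ler_wpM2r ?invr_ge0 ?exprn_ge0 // side_sum.
pose meets (k : nat) q := `[< exists2 x, A k x & box q x >].
have cov k : (k < m)%N -> fcov (A k) (\sum_(q <- s | meets k q) vol q).
  move=> km; exists [seq q <- s | meets k q]; split.
  - by move=> q; rewrite mem_filter => /andP[_ /ws]; apply.
  - move=> x Ax; have [q qs qx] := cs _ (Ap _ km _ Ax); exists q => //.
    by rewrite mem_filter qs andbT; apply/asboolP; exists x.
  - by rewrite big_filter.
(* The cells have sides at most [d], so by separation each cell meets at most one of the sets and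
   its volume is counted at most once. *)
have tot : \sum_(k < m) \sum_(q <- s | meets k q) vol q <= vol p.
  have -> : vol p = \sum_(q <- s) vol q by symmetry; apply: (gs (fun=> id)).
  under eq_bigr do rewrite big_mkcond.
  rewrite exchange_big /= big_seq [leRHS]big_seq; apply: ler_sum => q qs.
  rewrite -big_mkcond /=.
  have [[k mk]|none] := pselect (exists k : 'I_m, meets k q); last first.
    rewrite big1 ?vol_ge0 //; first exact: ws.
    by move=> k mk; case: none; exists k.
  rewrite (big_pred1 k) // => j; rewrite pred1E.
  rewrite eq_sym; apply/idP/eqP => [mj|->//]; apply/val_inj.
  have close u v : box q u -> box q v -> forall i, `|u i - v i| <= d.
    move=> qu qv i; apply: le_trans (sd q i qs).
    have := qu i; have := qv i; rewrite /side ler_norml.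
    by move=> /andP[? ?] /andP[? ?]; apply/andP; split; lra.
  case: (ltngtP j k) => //.
    move=> jk; move/asboolP: mj => [u Au qu]; move/asboolP: mk => [v Av qv].
    by case: (sep j k u v _ Au Av); [rewrite jk ltn_ord|apply: close].
  move=> jk; move/asboolP: mj => [u Au qu]; move/asboolP: mk => [v Av qv].
  by case: (sep k j v u _ Av Au); [rewrite jk ltn_ord|apply: close].
apply: contrapT => none.
have big (k : 'I_m) : vol p / m%:R < \sum_(q <- s | meets k q) vol q.
  rewrite ltNge; apply/negP => le; apply: none; exists k => //.
  exact: fcov_le le (cov k (ltn_ord k)).
have : \sum_(k < m) vol p / m%:R < \sum_(k < m) \sum_(q <- s | meets k q) vol q.
  apply: ltr_sum; last by move=> k _.
  by apply/hasP; exists (Ordinal m0); rewrite ?mem_index_enum.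
rewrite sumr_const card_ord -[(_ / _) *+ m]mulr_natr divfK ?pnatr_eq0 -?lt0n //.
by rewrite ltNge tot.
Qed.

End Boxes.

(** * Shears do not increase outer content *)

Section Shear.
Variables (R : realType) (I : finType) (P : pred I).
Variables (g : (I -> R) -> I -> R) (K : R).
Hypothesis K0 : 0 <= K.
Hypothesis g0 : forall z i, ~~ P i -> g z i = 0.
Hypothesis gL : forall z z' (e : R), 0 <= e -> (forall i, ~~ P i -> `|z i - z' i| <= e) ->
  forall i, `|g z i - g z' i| <= K * e.

(** By [g0] only coordinates in [P] are displaced; by [gL], taken with e = 0, the displacement
    depends only on the others. *)
Definition shear (z : I -> R) : I -> R := fun i => z i + g z i.

(** The box is cut only in the directions outside [P], so finely that [g] varies by at most K d on a
    piece. Each piece lands in a translate of itself, fattened by K d at both ends in the directions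
    of [P]. Those sides are uncut, so the total volume is the product of the sides with 2 K d added
    in [P], which [prod_fatten] controls. *)
Lemma fcov_shear_box p (e : R) : wf_box p -> 0 < e ->
  fcov [set shear x | x in box p] (vol p + e).
Proof.
move=> wp e0; pose b i := if P i then 2 * K else 0.
have b0 i : 0 <= b i by rewrite /b; case: ifP => // _; rewrite mulr_ge0.
have [d d0 dP] := prod_fatten (index_enum I) e0 (fun i => side_ge0 i wp) b0.
have [n nP] := geometric_small (\sum_j side p j) d0.
have [ws cs ss gs] := bisectsP n p (enum_uniq [pred i | ~~ P i]).
set s := bisects _ n p in ws cs ss gs.
have sd q i : q \in s -> ~~ P i -> side q i <= d.
  move=> qs Pi; rewrite ss // mem_enum /= inE Pi; apply: le_trans nP.
  by rewrite ler_wpM2r ?invr_ge0 ?exprn_ge0 // side_sum.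
pose G i r := if P i then r + 2 * K * d else r : R.
pose lo (q : (I -> R) * (I -> R)) i := q.1 i + g q.1 i - (if P i then K * d else 0).
pose hi (q : (I -> R) * (I -> R)) i := q.2 i + g q.1 i + (if P i then K * d else 0).
pose fat (q : (I -> R) * (I -> R)) := (lo q, hi q).
have side_fat q i : side (fat q) i = G i (side q i).
  rewrite /side /fat /lo /hi /G /=; case: ifPn => [_|Pi]; first by ring.
  by rewrite g0 //; ring.
exists (map fat s); split.
- move=> _ /mapP[q qs ->] i; rewrite -subr_ge0 -/(side _ _) side_fat /G.
  have wq := ws wp _ qs.
  case: ifP => _; last exact: side_ge0.
  by rewrite addr_ge0 ?side_ge0 // !mulr_ge0 // ltW.
- move=> _ [x px <-]; have [q qs qx] := cs x px.
  exists (fat q); first exact: map_f.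
  move=> i; have qxi := qx i; rewrite /fat /lo /hi /shear /=.
  case: ifPn => [_|Pi]; last by rewrite !g0 //; move: qxi; lra.
  have : `|g x i - g q.1 i| <= K * d.
    apply: gL => [|j Pj]; first exact: ltW.
    apply: le_trans (sd q j qs Pj).
    have := qx j; rewrite /side ler_norml => /andP[? ?].
    by apply/andP; split; lra.
  by rewrite ler_norml; move: qxi => /andP[? ?] /andP[? ?]; apply/andP; split; lra.
- rewrite big_map (eq_bigr (gvol G)); last first.
    by move=> q _; apply: eq_bigr => i _; rewrite side_fat.
  rewrite gs; last first.
    by move=> i; rewrite mem_enum inE /G => /negbTE Pi; apply/funext => r; rewrite Pi.
  apply: le_trans dP; rewrite le_eqVlt; apply/orP; left; apply/eqP.
  by apply: eq_bigr => i _; rewrite /G /b; case: ifP; rewrite ?mul0r ?addr0.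
Qed.

Lemma fcov_shear A v (e : R) : 0 < e -> fcov A v -> fcov [set shear x | x in A] (v + e).
Proof.
move=> e0 [s [ws cs ss]].
suff [e' [e'0 e'e cov]] : exists e', [/\ 0 <= e', e' <= e &
    fcov [set shear x | x in [set x | exists2 p, p \in s & box p x]]
         (\sum_(p <- s) vol p + e')].
  apply: fcov_le cov; last by rewrite lerD.
  by move=> _ [x /cs xs <-]; exists x.
elim: s e e0 ws {cs ss} => [|p s IH] e e0 ws.
  exists 0; split; rewrite ?(ltW e0) //; exists [::]; split => //.
    by move=> _ [x [p //]].
  by rewrite !big_nil addr0.
have [||e' [e'0 e'e cov]] := IH (e / 2).
- by rewrite divr_gt0.
- by move=> q qs; apply: ws; rewrite inE qs orbT.
have wp : wf_box p by apply: ws; rewrite inE eqxx.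
exists (e / 2 + e'); split; first by rewrite addr_ge0 // ltW // divr_gt0.
  by rewrite [leRHS]splitr lerD2l.
have covp := fcov_shear_box wp (divr_gt0 e0 (ltr0Sn R 1)).
apply: fcov_le (fcov_cat covp cov); last first.
  by rewrite big_cons; lra.
move=> _ [x [q +] qx <-]; rewrite inE => /orP[/eqP qp|qs]; [left|right].
  by exists x => //; rewrite -qp.
by exists x => //; exists q.
Qed.

End Shear.

(** * Splitting scheme for a bipartite vector field *)

Section Dynamics.
Variables (R : realType) (I : finType) (P : pred I).
Variables (f : (I -> R) -> I -> R) (L M : R).
Implicit Types (z : I -> R) (A : set (I -> R)) (h e t s r : R).

Definition close (e : R) z z' := forall i, `|z i - z' i| <= e.

Hypothesis L0 : 0 <= L.
Hypothesis M0 : 0 <= M.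
Hypothesis fL : forall z z' (e : R), close e z z' -> close (L * e) (f z) (f z').
Hypothesis fM : forall z i, `|f z i| <= M.

(* On the coordinates in Q, f only depends on the coordinates outside Q, so
   that moving the former along f is a shear. *)
Definition blind (Q : pred I) := forall z z', (forall i, ~~ Q i -> z i = z' i) ->
  forall i, Q i -> f z i = f z' i.

Definition kick (Q : pred I) (h : R) z : I -> R :=
  fun i => if Q i then z i + h * f z i else z i.

(** The displacement does not see the coordinates it moves, so it can be subtracted again. *)
Lemma kickK Q h : blind Q -> cancel (kick Q h) (kick Q (- h)).
Proof.
move=> bQ z; apply/funext => i; rewrite {1}/kick; case: ifPn => Qi; last first.
  by rewrite /kick (negbTE Qi).
rewrite (bQ (kick Q h z) z) //; first by rewrite /kick Qi; ring.
by move=> j /negbTE Qj; rewrite /kick Qj.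
Qed.

Lemma close_kick Q h e z z' : 0 <= e -> close e z z' ->
  close ((1 + `|h| * L) * e) (kick Q h z) (kick Q h z').
Proof.
move=> e0 c i; have hL : 0 <= `|h| * L by rewrite mulr_ge0.
rewrite /kick mulrDl mul1r; case: ifP => _; last first.
  by apply: le_trans (c i) _; rewrite lerDl mulr_ge0.
have -> : z i + h * f z i - (z' i + h * f z' i) =
  (z i - z' i) + h * (f z i - f z' i) by ring.
apply: le_trans (ler_normD _ _) _; apply: lerD (c i) _.
by rewrite normrM -mulrA ler_wpM2l //; apply: fL.
Qed.

(** Outer content does not increase; the slack [e] is there because the infimum over finite covers
    need not be attained. *)
Definition contracts_content (phi : (I -> R) -> I -> R) := forall A (v e : R), 0 < e ->
  fcov A v -> fcov [set phi z | z in A] (v + e).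

Lemma contracts_comp phi psi : contracts_content phi -> contracts_content psi ->
  contracts_content (phi \o psi).
Proof.
move=> cphi cpsi A v e e0 cA; have e2 : 0 < e / 2 by rewrite divr_gt0.
have -> : v + e = v + e / 2 + e / 2 by rewrite -addrA -splitr.
apply: fcov_le (cphi _ _ _ e2 (cpsi _ _ _ e2 cA)) => //.
by move=> _ [z Az <-]; exists (psi z) => //; exists z.
Qed.

Lemma contracts_iter phi n : contracts_content phi -> contracts_content (iter n phi).
Proof.
move=> cphi; elim: n => [|n IH]; last exact: contracts_comp.
move=> A v e e0; apply: fcov_le => [_ [z Az <-] //|].
by rewrite lerDl ltW.
Qed.

Lemma contracts_kick Q h : blind Q -> contracts_content (kick Q h).
Proof.
move=> bQ A v e e0 cA.
pose g z i := if Q i then h * f z i else 0.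
have K0 : 0 <= `|h| * L by rewrite mulr_ge0.
have g0 z i : ~~ Q i -> g z i = 0 by rewrite /g => /negbTE->.
have gL z z' (d : R) : 0 <= d -> (forall i, ~~ Q i -> `|z i - z' i| <= d) ->
    forall i, `|g z i - g z' i| <= `|h| * L * d.
  move=> d0 c i; rewrite /g; case: ifP => Qi; last by rewrite subrr normr0 mulr_ge0.
  (* Blindness allows replacing [z] by [z2], which differs from [z'] only outside [Q], where the
     distance is controlled. *)
  pose z2 j := if Q j then z' j else z j.
  rewrite (bQ z z2) //; last by move=> j /negbTE Qj; rewrite /z2 Qj.
  rewrite -mulrBr normrM -mulrA ler_wpM2l //; apply: fL => j.
  rewrite /z2; case: ifPn => [|/c //]; by rewrite subrr normr0.
have := fcov_shear K0 g0 gL e0 cA; apply: fcov_le => // _ [z Az <-].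
exists z => //; apply/funext => i; rewrite /shear /kick /g.
by case: ifP; rewrite ?addr0.
Qed.

Definition solution (w : R -> I -> R) :=
  (forall i, {within `[0, +oo[, continuous (fun t => w t i)}) /\
  forall t : R, 0 < t -> forall i, is_derive t 1 (fun s => w s i) (f (w t) i).

Lemma solution_mvt w t s i : solution w -> 0 <= t -> 0 < s ->
  exists2 r, t < r < t + s & w (t + s) i - w t i = f (w r) i * s.
Proof.
move=> [cw dw] t0 s0; have ts : t < t + s by rewrite ltrDl.
have [||r] := @MVT R (fun u => w u i) (fun u => f (w u) i) t (t + s) ts.
- by move=> u; rewrite in_itv /= => /andP[tr _]; apply: dw; apply: le_lt_trans tr.
- apply: continuous_subspaceW (cw i) => u /=; rewrite !in_itv /= => /andP[tu _].
  by rewrite andbT (le_trans t0).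
- rewrite in_itv /= => tr ->; exists r => //; congr (_ * _); ring.
Qed.

Lemma solution_lip w t r i : solution w -> 0 <= t -> t <= r ->
  `|w r i - w t i| <= M * (r - t).
Proof.
move=> sw t0; rewrite le_eqVlt => /orP[/eqP<-|tr].
  by rewrite !subrr normr0 mulr0.
have [|u _] := solution_mvt (s := r - t) i sw t0; first by rewrite subr_gt0.
have -> : t + (r - t) = r by ring.
by move=> ->; rewrite normrM (gtr0_norm (x := r - t)) ?subr_gt0 // ler_wpM2r // subr_ge0 ltW.
Qed.

(** The mean value theorem gives the slope at some intermediate time, and the Lipschitz bound moves
    it to any [r] in the step: r = t serves the scheme, r = t + s the energy estimate. *)
Lemma solution_euler w t s r i : solution w -> 0 <= t -> 0 < s -> t <= r <= t + s ->
  `|w (t + s) i - w t i - s * f (w r) i| <= L * M * s ^+ 2.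
Proof.
move=> sw t0 s0 /andP[tr rs]; have [u /andP[tu us] ->] := solution_mvt i sw t0 s0.
have -> : f (w u) i * s - s * f (w r) i = s * (f (w u) i - f (w r) i) by ring.
rewrite normrM gtr0_norm //.
have -> : L * M * s ^+ 2 = s * (L * (M * s)) by ring.
rewrite ler_wpM2l ?(ltW s0) //; apply: fL => j; case: (lerP r u) => ru.
  apply: le_trans (solution_lip j sw _ ru) _; first exact: le_trans tr.
  by rewrite ler_wpM2l //; lra.
rewrite distrC; apply: le_trans (solution_lip j sw _ (ltW ru)) _.
  by rewrite (le_trans t0) ?ltW.
by rewrite ler_wpM2l //; lra.
Qed.

Hypothesis fP : blind P.
Hypothesis fN : blind (predC P).

Definition step h z := kick (predC P) h (kick P h z).
Definition step_inv h z := kick P (- h) (kick (predC P) (- h) z).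

Lemma stepK h : cancel (step h) (step_inv h).
Proof. by move=> z; rewrite /step /step_inv !kickK. Qed.

Lemma close_step h e z z' : 0 <= h -> 0 <= e -> close e z z' ->
  close ((1 + h * L) ^+ 2 * e) (step h z) (step h z').
Proof.
move=> h0 e0 c; rewrite expr2 -mulrA /step -{1 2}(ger0_norm h0).
apply: close_kick; last exact: close_kick.
by rewrite mulr_ge0 // addr_ge0 // mulr_ge0.
Qed.

Lemma close_step_inv h e z z' : 0 <= h -> 0 <= e -> close e z z' ->
  close ((1 + h * L) ^+ 2 * e) (step_inv h z) (step_inv h z').
Proof.
move=> h0 e0 c; rewrite expr2 -mulrA /step_inv -{1 2}(ger0_norm h0) -normrN.
apply: close_kick; last exact: close_kick.
by rewrite mulr_ge0 // addr_ge0 // mulr_ge0.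
Qed.

Lemma contracts_step_inv h : contracts_content (step_inv h).
Proof. by apply: contracts_comp; apply: contracts_kick. Qed.

Lemma close_trans e e' z1 z2 z3 : close e z1 z2 -> close e' z2 z3 -> close (e + e') z1 z3.
Proof.
move=> c c' i; have -> : z1 i - z3 i = (z1 i - z2 i) + (z2 i - z3 i) by ring.
exact: le_trans (ler_normD _ _) (lerD (c i) (c' i)).
Qed.

Lemma close_sym e z z' : close e z z' -> close e z' z.
Proof. by move=> c i; rewrite distrC. Qed.

Lemma close_le e e' z z' : e <= e' -> close e z z' -> close e' z z'.
Proof. by move=> ee c i; apply: le_trans (c i) ee. Qed.

(** One L M h^2 is the Euler error; the other comes from evaluating the second kick at the point
    already moved by the first. *)
Lemma solution_step w t h : solution w -> 0 <= t -> 0 < h ->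
  close (2 * L * M * h ^+ 2) (w (t + h)) (step h (w t)).
Proof.
move=> sw t0 h0 i; have LM : 0 <= L * M * h ^+ 2 by rewrite mulr_ge0 ?sqr_ge0 // mulr_ge0.
have th : t <= t + h by rewrite lerDl ltW.
have eul := solution_euler i sw t0 h0 (r := t); rewrite lexx th in eul.
have {}eul := eul isT.
rewrite /step {1}/kick /=; case: ifPn => Pi; last first.
  rewrite /kick; move: Pi; rewrite negbK => ->; rewrite opprD addrA.
  by apply: le_trans eul _; lra.
set z' := kick P h (w t); have zi : z' i = w t i by rewrite /z' /kick (negbTE Pi).
rewrite zi.
have -> : w (t + h) i - (w t i + h * f z' i) =
  (w (t + h) i - w t i - h * f (w t) i) + h * (f (w t) i - f z' i) by ring.
apply: le_trans (ler_normD _ _) _.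
have : `|f (w t) i - f z' i| <= L * (M * h).
  apply: fL => j; rewrite /z' /kick; case: ifP => _.
    rewrite opprD addrA subrr add0r normrN normrM gtr0_norm // mulrC.
    by rewrite ler_wpM2r // ltW.
  by rewrite subrr normr0 mulr_ge0 // ltW.
move=> /(ler_wpM2l (ltW h0)); rewrite normrM gtr0_norm // => le2.
by apply: le_trans (lerD eul le2) _; rewrite le_eqVlt; apply/orP; left; apply/eqP; ring.
Qed.

(** Discrete Gronwall argument: n local errors, each amplified by at most the Lipschitz constant of
    n steps. *)
Lemma solution_iter_step w h n : solution w -> 0 < h ->
  close (n%:R * (2 * L * M * h ^+ 2) * (1 + h * L) ^+ (2 * n))
    (w (n%:R * h)) (iter n (step h) (w 0)).
Proof.
move=> sw h0; have hL : 0 <= h * L by rewrite mulr_ge0 // ltW.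
elim: n => [|n IH]; first by move=> i; rewrite !mul0r subrr normr0.
have nh : 0 <= n%:R * h by rewrite mulr_ge0 // ltW.
have E0 : 0 <= 2 * L * M * h ^+ 2 by rewrite mulr_ge0 ?sqr_ge0 // !mulr_ge0.
have -> : n.+1%:R * h = n%:R * h + h by rewrite -natr1; ring.
have c0 : 0 <= n%:R * (2 * L * M * h ^+ 2) * (1 + h * L) ^+ (2 * n).
  by rewrite mulr_ge0 ?exprn_ge0 ?addr_ge0 // mulr_ge0.
have := close_trans (solution_step sw nh h0) (close_step (ltW h0) c0 IH).
apply: close_le; rewrite mulnS exprD.
set q := (1 + h * L) ^+ 2; set r := _ ^+ (2 * n); set E := 2 * L * M * _ in E0 *.
have -> : n.+1%:R * E * (q * r) = n%:R * E * q * r + E * (q * r).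
  by rewrite -[n.+1%:R]natr1; ring.
have -> : q * (n%:R * E * r) = n%:R * E * q * r by ring.
rewrite addrC lerD2l ler_peMr // -exprD exprn_ege1 // lerDl //.
Qed.

Lemma exp_growth h n (T : R) : 0 <= h -> n%:R * h <= T ->
  (1 + h * L) ^+ (2 * n) <= expR (2 * L * T).
Proof.
move=> h0 nT; have hL : 0 <= h * L by rewrite mulr_ge0.
apply: (@le_trans _ _ (expR (h * L) ^+ (2 * n))).
  by rewrite lerXn2r ?nnegrE ?addr_ge0 // ?expR_ge0 // expR_ge1Dx.
rewrite -expRM_natl ler_expR natrM.
have -> : 2 * n%:R * (h * L) = 2 * L * (n%:R * h) by ring.
by rewrite ler_wpM2l // mulr_ge0.
Qed.

Lemma iter_stepK h n : cancel (iter n (step h)) (iter n (step_inv h)).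
Proof. by elim: n => // n IH z; rewrite iterSr iterS stepK IH. Qed.

Lemma close_iter_step_inv h e n z z' : 0 <= h -> 0 <= e -> close e z z' ->
  close ((1 + h * L) ^+ (2 * n) * e) (iter n (step_inv h) z) (iter n (step_inv h) z').
Proof.
move=> h0 e0 c; elim: n => [|n IH]; first by rewrite muln0 expr0 mul1r.
rewrite mulnS exprD -mulrA; apply: close_step_inv => //.
by rewrite mulr_ge0 // exprn_ge0 // addr_ge0 // mulr_ge0.
Qed.

Lemma nat_large (x : R) : exists n : nat, x <= n%:R.
Proof.
exists (Num.Def.archi_bound `|x|); apply: ltW.
exact: le_lt_trans (ler_norm _) (archi_boundP (normr_ge0 _)).
Qed.

Lemma div_small (x y : R) : 0 < y -> exists n : nat, x / n.+1%:R <= y.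
Proof.
move=> y0; have [n xn] := nat_large (x / y); exists n.
rewrite ler_pdivrMr ?ltr0Sn // mulrC -ler_pdivrMr //; apply: le_trans xn _.
by rewrite ler_nat.
Qed.

(* The sets step^(k n) B, k < m, are separated, so one of them has small
   content, and undoing the steps shows that B itself does. *)
Lemma fcov_nonrecurrent (B : set (I -> R)) (eps C : R) (N : nat) :
  0 < eps -> (0 < N)%N -> 0 <= C ->
  (forall x y, B x -> B y -> close (eps / 2) x y) ->
  (forall z, B z -> exists w, [/\ solution w, w 0 = z,
     forall (n : nat) i, `|w n%:R i| <= C &
     forall n, (N <= n)%N -> ~ close eps (w n%:R) z]) ->
  forall v : R, 0 < v -> fcov B v.
Proof.
move=> eps0 N0 C0 diam Bw v v0.
(* The margin 1 leaves room for the error of the scheme, made at most 1 below. *)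
pose p : (I -> R) * (I -> R) := (fun=> - (C + 1), fun=> C + 1).
have wp : wf_box p by move=> i /=; lra.
have [m' mP] := div_small (vol p) (divr_gt0 v0 (ltr0Sn R 1)).
set m := m'.+1 in mP.
pose T : R := (m * N)%:R; have T0 : 0 <= T by rewrite ler0n.
pose b := expR (2 * L * T); have b0 : 0 < b by rewrite expR_gt0.
have LM0 : 0 <= 2 * L * M by rewrite !mulr_ge0.
pose K := T * (2 * L * M) * b.
have K0 : 0 <= K by rewrite /K !mulr_ge0 // ltW.
have mn0 : 0 < Num.min (eps / 4) 1 by rewrite lt_min divr_gt0 //=.
have [n' nP] := div_small (K * N%:R) mn0.
(* With this step size, n steps cover exactly the time N, and the error K h up to time m N is at
   most eps / 4 and at most 1. *)
set n := n'.+1 in nP; pose h : R := N%:R / n%:R.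
have n0 : 0 < n%:R :> R by rewrite ltr0Sn.
have h0 : 0 < h by rewrite divr_gt0 // ltr0n.
pose e := K * h.
have e0 : 0 <= e by rewrite mulr_ge0 // ltW.
have [e4 e1] : e <= eps / 4 /\ e <= 1.
  by move: nP; rewrite -mulrA -/h -/e le_min => /andP[].
(* Undoing up to m n steps expands distances by at most [b], so points within [d] come from points
   within eps / 4. *)
pose d := eps / 4 / b; have d0 : 0 < d by rewrite !divr_gt0.
have nh k : (k * n)%:R * h = (k * N)%:R.
  by rewrite /h !natrM; field; rewrite gt_eqF.
have kT k : (k <= m)%N -> (k * n)%:R * h <= T.
  by move=> km; rewrite nh ler_nat leq_mul2r km orbT.
have grow k : (k <= m)%N -> (1 + h * L) ^+ (2 * (k * n)) <= b.
  by move=> km; apply: exp_growth; [exact: ltW|exact: kT].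
have g1 j : 0 <= (1 + h * L) ^+ j by rewrite exprn_ge0 // addr_ge0 // mulr_ge0 // ltW.
have approx w k : solution w -> (k <= m)%N ->
    close e (w (k * N)%:R) (iter (k * n) (step h) (w 0)).
  move=> sw km; rewrite -nh; apply: close_le (solution_iter_step _ sw h0).
  have -> : (k * n)%:R * (2 * L * M * h ^+ 2) = (k * n)%:R * h * (2 * L * M) * h by ring.
  have -> : e = T * (2 * L * M) * h * b by rewrite /e /K; ring.
  apply: ler_pM; rewrite ?g1 ?grow // ?mulr_ge0 // ?(ltW h0) //.
  by rewrite !ler_wpM2r ?(ltW h0) // kT.
pose A k := [set iter (k * n) (step h) z | z in B].
have [||k km cov] :=
    @fcov_pigeonhole R I m A p d wp d0 isT.
- move=> k km _ [z Bz <-] i; have [w [sw w0 wC _]] := Bw z Bz.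
  have := approx w k sw (ltnW km) i; rewrite w0 => c.
  have := wC (k * N)%N i; move: c; rewrite !ler_norml /=.
  by move=> /andP[? ?] /andP[? ?]; apply/andP; split; lra.
(* Undoing j n steps puts the orbit of [y] after (k - j) n steps within eps / 4 of [x]. Adding the
   scheme error eps / 4 and the diameter bound eps / 2, the solution from [y] is within eps of [y]
   at time (k - j) N >= N, a contradiction. *)
- move=> j k u u' /andP[jk km] [x Bx <-] [y By <-] cl.
  have [w [sw w0 _ wN]] := Bw y By.
  apply: (wN ((k - j) * N)%N).
    by rewrite leq_pmull // subn_gt0.
  have kj : (k - j <= m)%N by rewrite (leq_trans (leq_subr _ _)) // ltnW.
  have jm : (j <= m)%N by rewrite ltnW // (ltn_trans jk).
  have := close_iter_step_inv (j * n) (ltW h0) (ltW d0) cl.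
  have -> : (k * n = j * n + (k - j) * n)%N by rewrite -mulnDl subnKC // ltnW.
  rewrite iterD !iter_stepK => cx.
  have ap := approx w (k - j)%N sw kj; rewrite w0 in ap.
  have := close_trans (close_trans ap (close_sym cx)) (diam _ _ Bx By).
  apply: close_le.
  have : (1 + h * L) ^+ (2 * (j * n)) * d <= eps / 4.
    rewrite /d mulrCA ger_pMr ?divr_gt0 // ler_pdivrMr // mul1r; exact: grow.
  lra.
- have cc := @contracts_iter _ (k * n)%N (contracts_step_inv h).
  have := cc _ _ _ (divr_gt0 v0 (ltr0Sn R 1)) cov; apply: fcov_le; last first.
    by rewrite [leRHS]splitr lerD2r.
  move=> z Bz; exists (iter (k * n) (step h) z); last exact: iter_stepK.
  by exists z.
Qed.

End Dynamics.

(** * From finite covers to Lebesgue null sets *)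

Section Null.
Variables (R : realType) (I : finType).

Lemma lebesgue_null_sub (A B : set (I -> R)) :
  A `<=` B -> lebesgue_null B -> lebesgue_null A.
Proof.
move=> AB nB eps /nB[a [b [ab cov s]]]; exists a, b; split => //.
exact: subset_trans cov.
Qed.

(** The n-th set gets a finite cover of volume eps / 2^(n+1); the covers are concatenated into one
    sequence of boxes. *)
Lemma lebesgue_null_bigcup (K : countType) (B : K -> set (I -> R)) (i0 : I) :
  (forall k v, 0 < v -> fcov (B k) v) -> lebesgue_null [set z | exists k, B k z].
Proof.
move=> Bc eps eps0.
have : forall n : nat, exists s : seq ((I -> R) * (I -> R)), [/\
    forall p, p \in s -> wf_box p, (0 < size s)%N,
    forall k, unpickle n = Some k -> forall x, B k x -> exists2 p, p \in s & box p x &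
    \sum_(p <- s) vol p <= eps / 2 ^+ n.+1].
  move=> n; have en : 0 < eps / 2 ^+ n.+1 by rewrite divr_gt0 // exprn_gt0.
  (* This degenerate box pads every list, so that the first n lists contain at least n boxes. Its
     volume vanishes thanks to the coordinate [i0]; an empty product would be 1. *)
  pose z : (I -> R) * (I -> R) := (fun=> 0, fun=> 0).
  have vz : vol z = 0.
    by rewrite /vol (bigD1 i0) //= /side subrr mul0r.
  have wz : wf_box z by move=> i /=.
  case un : (unpickle n) => [k|]; last first.
    exists [:: z]; split => //; first by move=> p; rewrite inE => /eqP->.
    by rewrite big_seq1 vz ltW.
  have [s [ws cs ss]] := Bc k _ en; exists (z :: s); split => //.
  - by move=> p; rewrite inE => /orP[/eqP->//|/ws].
  - by move=> _ [<-] x /cs[p ps px]; exists p => //; rewrite inE ps orbT.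
  - by rewrite big_cons vz add0r.
move=> /choice[s sP].
pose S n := flatten [seq s k | k <- iota 0 n].
have SD m n : S (m + n)%N = S m ++ flatten [seq s k | k <- iota m n].
  by rewrite /S iotaD map_cat flatten_cat add0n.
have Ssz n : (n <= size (S n))%N.
  elim: n => // n IH; rewrite -addn1 SD size_cat leq_add //= cats0.
  by have [] := sP n.
pose z : (I -> R) * (I -> R) := (fun=> 0, fun=> 0).
have SE m n j : (m <= n)%N -> (j < size (S m))%N -> nth z (S n) j = nth z (S m) j.
  by move=> mn jm; rewrite -(subnKC mn) SD nth_cat jm.
have Swf n p : p \in S n -> wf_box p.
  by move=> /flatten_mapP[k _ pk]; have [+ _ _ _] := sP k; apply.
have Ssum n : \sum_(p <- S n) vol p <= eps * (1 - (2 ^+ n)^-1).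
  elim: n => [|n IH]; first by rewrite /S /= big_nil expr0 invr1 subrr mulr0.
  rewrite -addn1 SD big_cat /= cats0; have [_ _ _ sn] := sP n.
  apply: le_trans (lerD IH sn) _; rewrite addn1 exprS le_eqVlt; apply/orP; left.
  by apply/eqP; field; rewrite expf_neq0 // pnatr_eq0.
(* The n-th box of the infinite concatenation: [S n.+1] has at least n + 1 boxes, and longer
   prefixes agree with it. *)
pose q n := nth z (S n.+1) n.
exists (fun n => (q n).1), (fun n => (q n).2); split.
- move=> n; apply: (Swf n.+1); exact: mem_nth.
- move=> x [k Bx]; have [_ _ /(_ k (pickleK k) x Bx)[p ps px] _] := sP (pickle k).
  have pS : p \in S (pickle k).+1.
    by rewrite /S; apply/flatten_mapP; exists (pickle k); rewrite ?mem_iota ?add0n ?ltnSn.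
  have iS : (index p (S (pickle k).+1) < size (S (pickle k).+1))%N by rewrite index_mem.
  exists (index p (S (pickle k).+1)) => //.
  suff -> : q (index p (S (pickle k).+1)) = p by [].
  rewrite -[RHS](nth_index z pS) /q; set j := index _ _ in iS *.
  have [jk|kj] := leqP j.+1 (pickle k).+1; last by apply: SE => //; exact: ltnW.
  by symmetry; apply: SE.
- move=> n; apply: (@le_trans _ _ (\sum_(p <- S n) vol p)); last first.
    apply: le_trans (Ssum n) _; rewrite ger_pMr // lerBlDr lerDl invr_ge0.
  rewrite -[X in _ <= \sum_(p <- X) _](cat_take_drop n (S n)) big_cat /=.
  rewrite -[leLHS]addr0; apply: lerD; last first.
    rewrite big_seq; apply: sumr_ge0 => p /mem_drop /Swf; exact: vol_ge0.
  rewrite (big_nth z) size_take_min (minn_idPl (Ssz n)) big_mkord.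
  apply: ler_sum => j _; rewrite nth_take // /vol /side /q (SE j.+1) //.
Qed.

Variables (P : pred I) (f : (I -> R) -> I -> R) (L M : R).
Hypothesis L0 : 0 <= L.
Hypothesis M0 : 0 <= M.
Hypothesis fL : forall z z' (e : R), close e z z' -> close (L * e) (f z) (f z').
Hypothesis fM : forall z i, `|f z i| <= M.
Hypothesis fP : blind f P.
Hypothesis fN : blind f (predC P).

Theorem lebesgue_null_nonrecurrent (i0 : I) : lebesgue_null
  [set z | exists w, [/\ solution f w, w 0 = z,
     exists C : R, forall (n : nat) i, `|w n%:R i| <= C &
     exists2 e : R, 0 < e & exists N, forall n, (N <= n)%N -> ~ close e (w n%:R) z]].
Proof.
(* A single integer controls the orbit bound, the return distance and the time threshold. The second
   index is a cell of a grid of mesh half the return distance, the diameter that [fcov_nonrecurrent]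
   asks for. *)
pose B (mk : nat * {ffun I -> int}) z := (exists w, [/\ solution f w, w 0 = z,
     forall (n : nat) i, `|w n%:R i| <= mk.1%:R &
     forall n, (mk.1.+1 <= n)%N -> ~ close (mk.1.+1%:R^-1) (w n%:R) z]) /\
   forall i, (mk.2 i)%:~R <= z i * (2 * mk.1.+1%:R) <= (mk.2 i)%:~R + 1.
apply: lebesgue_null_sub (@lebesgue_null_bigcup _ B i0 _).
  move=> z [w [sw w0 [C wC] [e e0 [N wN]]]].
  have [m1 m1P] := nat_large C; have [m2 m2P] := div_small 1 e0.
  pose m := (maxn N (maxn m1 m2)).
  exists (m, [ffun i => Num.floor (z i * (2 * m.+1%:R))]); split.
    exists w; split => //=.
    - move=> n i; apply: le_trans (wC n i) _; apply: le_trans m1P _.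
      by rewrite ler_nat /m !leq_max leqnn orbT.
    - move=> n mn /= c; apply: (wN n).
        by apply: leq_trans mn; apply: leqW; rewrite /m leq_max leqnn.
      apply: close_le c; apply: le_trans m2P; rewrite div1r lef_pV2 ?posrE ?ltr0Sn //.
      by rewrite ler_nat ltnS /m !leq_max leqnn !orbT.
  move=> i /=; rewrite ffunE floor_le_tmp /=; apply: ltW.
  by rewrite -intrD1 floorD1_gt.
move=> [m k] v v0 /=.
have m0 : 0 < m.+1%:R :> R by rewrite ltr0Sn.
apply: (fcov_nonrecurrent L0 M0 fL fM fP fN (eps := m.+1%:R^-1) (C := m%:R) (N := m.+1)) => //.
- move=> x y [_ Bx] [_ By] i; move: (Bx i) (By i) => /= /andP[x1 x2] /andP[y1 y2].
  have D0 : 0 < 2 * m.+1%:R :> R by rewrite mulr_gt0.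
  have -> : m.+1%:R^-1 / 2 = 1 / (2 * m.+1%:R) :> R by rewrite -invfM div1r mulrC.
  rewrite ler_pdivlMr // -(gtr0_norm D0) -normrM mulrBl ler_norml.
  by apply/andP; split; lra.
- by move=> z [].
Qed.

End Null.

(** * Regularizers and mirror maps *)

Section SupportLines.
Variable R : realType.
Implicit Types (g theta : R -> R).

(** Convexity through supporting lines. The point 0 is left out because the slope may be infinite
    there, as for x log x. *)
Definition support_lines g := forall a : R, 0 < a <= 1 ->
  exists s, forall x, 0 <= x <= 1 -> g a + s * (x - a) <= g x.

Lemma jensen (K : finType) g (p x : K -> R) : support_lines g ->
  (forall k, 0 <= p k) -> \sum_k p k = 1 -> (forall k, 0 <= x k <= 1) ->
  g (\sum_k p k * x k) <= \sum_k p k * g (x k).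
Proof.
move=> sg p0 p1 x01; set a := \sum_k p k * x k.
have px0 k : 0 <= p k * x k by rewrite mulr_ge0 //; case/andP: (x01 k).
have a0 : 0 <= a by apply: sumr_ge0 => k _.
have a1 : a <= 1.
  rewrite -p1; apply: ler_sum => k _; rewrite ler_piMr //.
  by case/andP: (x01 k).
move: a0; rewrite le_eqVlt => /orP[/eqP a0|a0]; last first.
  have [|s sP] := sg a; first by rewrite a0 a1.
  apply: (@le_trans _ _ (\sum_k p k * (g a + s * (x k - a)))).
    under eq_bigr do rewrite mulrDr mulrCA mulrBr.
    rewrite big_split /= -mulr_suml p1 mul1r -mulr_sumr sumrB -mulr_suml p1 mul1r.
    by rewrite subrr mulr0 addr0.
  by apply: ler_sum => k _; rewrite ler_wpM2l // sP.
(* If the mean is 0, all points of positive weight are 0 and the inequality is an equality. *)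
have px k : p k * x k = 0.
  apply/eqP; move/esym/eqP: a0; rewrite psumr_eq0 // => /allP/(_ k).
  by rewrite mem_index_enum => /(_ isT).
rewrite -a0 -[leLHS]mul1r -p1 mulr_suml; apply: ler_sum => k _.
by have /eqP := px k; rewrite mulf_eq0 => /orP[/eqP->|/eqP->]; rewrite ?mul0r.
Qed.

Lemma support_mid g x y : support_lines g -> 0 <= x <= 1 -> 0 <= y <= 1 ->
  g ((x + y) / 2) <= (g x + g y) / 2.
Proof.
move=> sg x01 y01.
have := @jensen bool g (fun=> 2^-1) (fun b => if b then x else y) sg.
rewrite !big_bool /= => /(_ _ _ _) H; have -> : (x + y) / 2 = 2^-1 * x + 2^-1 * y by ring.
have -> : (g x + g y) / 2 = 2^-1 * g x + 2^-1 * g y by ring.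
by apply: H => // [|[]] //; lra.
Qed.

Lemma support_lower g : support_lines g -> exists m, forall x, 0 <= x <= 1 -> m <= g x.
Proof.
move=> sg; have [|s sP] := sg 1; first by rewrite ltr01 lexx.
exists (g 1 - `|s|) => x x01; apply: le_trans (sP x x01); rewrite lerD2l.
case/andP: x01 => x0 x1; rewrite lerNl -mulrN opprB.
apply: le_trans (ler_norm _) _; rewrite normrM ler_piMr // ger0_norm ?subr_ge0 //.
by rewrite lerBlDr lerDl.
Qed.

(** Subtract from [theta] the linear and quadratic terms at [a]. The lower bound on the second
    derivative makes the derivative of the difference [phi] have the sign of y - a, so [phi] is
    smallest at [a]; continuity at 0 suffices for the mean value theorem down to x = 0. *)
Lemma admissible_quadratic theta : admissible_theta theta -> exists2 c : R, 0 < c &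
  forall a x : R, 0 < a <= 1 -> 0 <= x <= 1 ->
    theta a + derive1 theta a * (x - a) + c / 2 * (x - a) ^+ 2 <= theta x.
Proof.
move=> [ct th0 d1 d2 [c [c0 cP]]]; exists c => // a x a01 x01.
have gap u v : 0 < u -> u < v -> v <= 1 -> c * (v - u) <= derive1 theta v - derive1 theta u.
  move=> u0 uv v1.
  have [||r] := @MVT R (derive1 theta) (derive1 (derive1 theta)) u v uv.
  - move=> r; rewrite in_itv /= => /andP[ur rv].
    by rewrite derive1E; apply/derivableP/d2; rewrite (lt_trans u0) // (le_trans (ltW rv)).
  - apply: derivable_within_continuous => r; rewrite in_itv /= => /andP[ur rv].
    by apply: d2; rewrite (lt_le_trans u0) // (le_trans rv).
  - rewrite in_itv /= => /andP[ur rv] ->; rewrite ler_wpM2r ?subr_ge0 ?(ltW uv) //.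
    by apply: cP; rewrite (lt_trans u0) //= (le_trans (ltW rv)).
pose q (y : R) := derive1 theta a * (y - a) + c / 2 * (y - a) ^+ 2.
pose phi y := theta y - q y.
pose dphi y := derive1 theta y - (derive1 theta a + c * (y - a)).
have dq (y : R) : is_derive y 1 q (derive1 theta a + c * (y - a)).
  rewrite /q; apply: is_derive_eq.
  rewrite /GRing.scale /=; lra.
have dphiP (y : R) : 0 < y <= 1 -> is_derive y 1 phi (dphi y).
  move=> y01; have dt : is_derive y 1 theta (derive1 theta y).
    by rewrite derive1E; apply/derivableP/d1.
  exact: is_deriveB.
have cphi : {within `[0, 1], continuous phi}.
  move=> y; apply: cvgB; first exact: ct.
  apply: continuous_subspaceT => z.
  by apply/differentiable_continuous/derivable1_diffP; apply: ex_derive.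
suff : phi a <= phi x by rewrite /phi /q subrr mulr0 expr0n /= mulr0; lra.
case/andP: a01 => a0 a1; case/andP: x01 => x0 x1.
case: (ltgtP x a) => [xa|ax|->//].
  have [||r] := @MVT R phi dphi x a xa.
  - move=> r; rewrite in_itv /= => /andP[xr ra]; apply: dphiP.
    by rewrite (le_lt_trans x0) //= (le_trans (ltW ra)).
  - apply: continuous_subspaceW cphi => r /=; rewrite !in_itv /= => /andP[? ?].
    by apply/andP; split; lra.
  - rewrite in_itv /= => /andP[xr ra] e.
    rewrite -subr_ge0 -opprB e -mulNr mulr_ge0 ?subr_ge0 ?(ltW xa) //.
    have := gap r a; rewrite /dphi (le_lt_trans x0) // => /(_ isT ra a1); lra.
have [||r] := @MVT R phi dphi a x ax.
- move=> r; rewrite in_itv /= => /andP[ar rx]; apply: dphiP.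
  by rewrite (lt_trans a0) //= (le_trans (ltW rx)).
- apply: continuous_subspaceW cphi => r /=; rewrite !in_itv /= => /andP[? ?].
  by apply/andP; split; lra.
- rewrite in_itv /= => /andP[ar rx] e; rewrite -subr_ge0 e mulr_ge0 ?subr_ge0 ?(ltW ax) //.
  have := gap a r a0 ar; rewrite (le_trans (ltW rx)) // => /(_ isT); rewrite /dphi; lra.
Qed.

Lemma support_quadratic theta c : (forall a x : R, 0 < a <= 1 -> 0 <= x <= 1 ->
    theta a + derive1 theta a * (x - a) + c / 2 * (x - a) ^+ 2 <= theta x) ->
  support_lines (fun x => theta x - c / 2 * x ^+ 2).
Proof.
move=> q a a01; exists (derive1 theta a - c * a) => x x01; have := q a x a01 x01.
by rewrite -subr_ge0 => q0; rewrite -subr_ge0; move: q0; congr (0 <= _); field.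
Qed.

Lemma within_unit_eps theta : {within `[0, 1], continuous theta} ->
  forall x e : R, 0 <= x <= 1 -> 0 < e -> exists2 d : R, 0 < d &
    forall y, 0 <= y <= 1 -> `|x - y| < d -> `|theta x - theta y| < e.
Proof.
move=> ct x e x01 e0.
have /cvgrPdist_lt/(_ e e0) := ct x.
rewrite /prop_near1 /nbhs /= -nbhs_subspace_in; last by rewrite /= in_itv.
rewrite /within /= => /nbhs_ballP[d d0 dP]; exists d => // y y01 xy.
by apply: dP => //=; rewrite in_itv.
Qed.

End SupportLines.

Definition wdot (R : realType) (J : finType) (w a c : J -> R) : R :=
  \sum_b w b * a b * c b.

(** * Spectral theory and trace functions of Hermitian matrices *)

Section Hermitian.
Variable R : realType.
Local Notation C := R[i].
Local Notation Re := (@complex.Re R).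
Local Notation Im := (@complex.Im R).

Lemma complex_eq (x y : C) : Re x = Re y -> Im x = Im y -> x = y.
Proof. by move=> e1 e2; apply/eqP; rewrite eq_complex e1 e2 !eqxx. Qed.

Lemma ReD (x y : C) : Re (x + y) = Re x + Re y. Proof. by case: x; case: y. Qed.
Lemma ImD (x y : C) : Im (x + y) = Im x + Im y. Proof. by case: x; case: y. Qed.
Lemma ReM (x y : C) : Re (x * y) = Re x * Re y - Im x * Im y.
Proof. by case: x; case: y. Qed.
Lemma ImM (x y : C) : Im (x * y) = Re x * Im y + Im x * Re y.
Proof. by case: x; case: y. Qed.
Lemma ReZ (k : R) (x : C) : Re (k%:C%C * x) = k * Re x.
Proof. by rewrite ReM /= mul0r subr0. Qed.
Lemma Re_sum (K : finType) (F : K -> C) : Re (\sum_k F k) = \sum_k Re (F k).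
Proof. exact: (big_morph Re ReD (erefl _)). Qed.
Lemma Re_conjc (x : C) : Re (conjc x) = Re x. Proof. by case: x. Qed.
Lemma Im_conjc (x : C) : Im (conjc x) = - Im x. Proof. by case: x. Qed.

Lemma adjmxE m n (A : 'M[C]_(m, n)) i j : adjmx A i j = conjc (A j i).
Proof. by rewrite !mxE. Qed.

Lemma adjmx_trC m n (A : 'M[C]_(m, n)) : adjmx A = map_mx Num.conj A^T.
Proof. by apply/matrixP => i j; rewrite !mxE. Qed.

Lemma adjmxK m n (A : 'M[C]_(m, n)) : adjmx (adjmx A) = A.
Proof. by apply/matrixP => i j; rewrite !adjmxE conjcK. Qed.

Lemma adjmxM m n p (A : 'M[C]_(m, n)) (B : 'M[C]_(n, p)) :
  adjmx (A *m B) = adjmx B *m adjmx A.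
Proof. by rewrite /adjmx map_mxM trmx_mul. Qed.

Lemma unitaryC d (U : 'M[C]_d) : unitary U -> adjmx U *m U = 1%:M.
Proof. exact: mulmx1C. Qed.

Definition diagR d (lam : 'I_d -> R) : 'M[C]_d := diag_mx (\row_j (lam j)%:C%C).

Definition diagonalizes d (U : 'M[C]_d) (lam : 'I_d -> R) (X : 'M[C]_d) :=
  unitary U /\ X = U *m diagR lam *m adjmx U.

Lemma spectral_hermitian d (X : 'M[C]_d) : Defs.hermitian X ->
  exists U lam, diagonalizes U lam X.
Proof.
move=> hX; pose Q := spectralmx X; pose D := spectral_diag X.
have hs : X \is hermsymmx.
  by apply/is_hermitianmxP; rewrite expr0 scale1r -{1}hX adjmx_trC.
have iQ : invmx Q = adjmx Q.
  by rewrite adjmx_trC invmx_unitary // spectral_unitarymx.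
have XE : X = invmx Q *m diag_mx D *m Q.
  exact/orthomx_spectralP/hermitian_normalmx.
have /unitarymxP QU := spectral_unitarymx X.
have Dr := hermitian_spectral_diag_real hs.
exists (adjmx Q), (fun j => Re (D 0 j)); split.
  by rewrite /unitary adjmxK; apply: mulmx1C; rewrite adjmx_trC.
rewrite adjmxK [LHS]XE iQ.
congr (_ *m _ *m _); congr diag_mx; apply/rowP => j; rewrite mxE.
have /mxOverP/(_ 0 j)/CrealP := Dr; rewrite -/D => Dj; apply: complex_eq => //=.
have := congr1 Im Dj; rewrite Im_conjc => /eqP.
by rewrite eq_sym -subr_eq0 opprK -mulr2n mulrn_eq0 => /eqP.
Qed.

Definition qform d (v : 'cV[C]_d) (X : 'M[C]_d) : R := Re ((adjmx v *m X *m v) 0 0).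

(** For unitary W, the diagonal of X in the orthonormal basis of the columns of W. *)
Definition dgc d (W X : 'M[C]_d) j : R := Re ((adjmx W *m X *m W) j j).

Lemma dgc_qform d (W X : 'M[C]_d) j : dgc W X j = qform (col j W) X.
Proof.
rewrite /dgc /qform; congr Re; rewrite -!mulmxA !mxE; apply: eq_bigr => k _.
by rewrite !adjmxE !mxE; congr (_ * _); apply: eq_bigr => l _; rewrite !mxE.
Qed.

Lemma dgc_sum d (W X : 'M[C]_d) : unitary W -> \sum_j dgc W X j = Re (\tr X).
Proof.
move=> uW; rewrite -Re_sum -[\sum_j _]/(\tr _) -mulmxA mxtrace_mulC -mulmxA.
by rewrite uW mulmx1.
Qed.

Lemma dgc_diag d (U X : 'M[C]_d) lam : diagonalizes U lam X -> dgc U X =1 lam.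
Proof.
move=> [uU ->] j; have U1 := unitaryC uU; rewrite /dgc !mulmxA U1 mul1mx -mulmxA U1 mulmx1.
by rewrite !mxE eqxx mulr1n.
Qed.

Lemma density_dgc d (W X : 'M[C]_d) j : unitary W -> density X -> 0 <= dgc W X j <= 1.
Proof.
move=> uW [[hX pX] tX]; have ge0 k : 0 <= dgc W X k by rewrite dgc_qform; apply: pX.
rewrite ge0 /=; have := dgc_sum X uW; rewrite tX /= => <-.
by rewrite (bigD1 j) //= lerDl sumr_ge0.
Qed.

Lemma density_eig d (U X : 'M[C]_d) lam j : diagonalizes U lam X -> density X ->
  0 <= lam j <= 1.
Proof. by move=> dU dX; rewrite -(dgc_diag dU); apply: density_dgc => //; case: dU. Qed.

(* The diagonal in any orthonormal basis is a doubly stochastic average of the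
   eigenvalues. *)
Lemma dgc_mix d (W U X : 'M[C]_d) lam : unitary W -> diagonalizes U lam X ->
  exists p : 'I_d -> 'I_d -> R, [/\ forall j k, 0 <= p j k,
    forall j, \sum_k p j k = 1, forall k, \sum_j p j k = 1 &
    forall j, dgc W X j = \sum_k p j k * lam k].
Proof.
move=> uW [uU ->]; pose T := adjmx W *m U.
pose p j k := Re (T j k) ^+ 2 + Im (T j k) ^+ 2.
have uT : T *m adjmx T = 1%:M.
  by rewrite /T adjmxM adjmxK mulmxA -(mulmxA _ U) uU mulmx1 unitaryC.
have uT' := unitaryC uT.
exists p; split.
- by move=> j k; rewrite addr_ge0 // sqr_ge0.
- move=> j; have := congr1 (fun A : 'M[C]_d => Re (A j j)) uT.
  rewrite !mxE eqxx /= => <-; rewrite Re_sum; apply: eq_bigr => k _.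
  by rewrite adjmxE ReM Re_conjc Im_conjc /p; ring.
- move=> k; have := congr1 (fun A : 'M[C]_d => Re (A k k)) uT'.
  rewrite !mxE eqxx /= => <-; rewrite Re_sum; apply: eq_bigr => j _.
  by rewrite adjmxE ReM Re_conjc Im_conjc /p; ring.
- move=> j; rewrite /dgc.
  have -> : adjmx W *m (U *m diagR lam *m adjmx U) *m W = T *m diagR lam *m adjmx T.
    by rewrite /T adjmxM adjmxK !mulmxA.
  rewrite mul_mx_diag !mxE Re_sum; apply: eq_bigr => k _.
  rewrite adjmxE [X in Re (X * _)]mxE [(\row_j _) _ _]mxE.
  by rewrite !ReM !ImM Re_conjc Im_conjc /p /=; ring.
Qed.

(** Jensen's inequality in each row of the doubly stochastic matrix of [dgc_mix]; its columns then
    sum to one. *)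
Lemma peierls d g (W U X : 'M[C]_d) lam : support_lines g -> unitary W ->
  density X -> diagonalizes U lam X ->
  \sum_j g (dgc W X j) <= \sum_k g (lam k).
Proof.
move=> sg uW dX dU; have [p [p0 pr pc pE]] := dgc_mix uW dU.
apply: (@le_trans _ _ (\sum_j \sum_k p j k * g (lam k))).
  apply: ler_sum => j _; rewrite pE; apply: jensen => // k.
  exact: density_eig dU dX.
by rewrite exchange_big /=; under eq_bigr do rewrite -mulr_suml pc mul1r.
Qed.

(** [mxfun] uses some diagonalization obtained by choice. Applying [peierls] to it and to the given
    one, in both directions, shows that the sums agree, without matching the eigenvalues. *)
Lemma reg_eig theta d (U X : 'M[C]_d) lam : support_lines theta -> density X ->
  diagonalizes U lam X -> reg theta X = \sum_k theta (lam k).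
Proof.
move=> st dX dU; rewrite /reg /mxfun.
set S := [set M | _]; have : S (xget 0 S).
  apply: xgetPex; exists (U *m diagR (theta \o lam) *m adjmx U).
  by exists U, lam; case: dU.
move=> [U' [lam' [uU' XE ->]]]; have dU' : diagonalizes U' lam' X by [].
rewrite mxtrace_mulC mulmxA unitaryC // mul1mx mxtrace_diag Re_sum.
under eq_bigr do rewrite mxE /=.
have E1 : \sum_j theta (dgc U' X j) = \sum_j theta (lam' j).
  by apply: eq_bigr => j _; rewrite (dgc_diag dU').
have E2 : \sum_j theta (dgc U X j) = \sum_j theta (lam j).
  by apply: eq_bigr => j _; rewrite (dgc_diag dU).
apply/eqP; rewrite eq_le -{1}E1 -{2}E2.
by rewrite (peierls st (proj1 dU') dX dU) (peierls st (proj1 dU) dX dU').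
Qed.

Lemma reg_ge theta d (W X : 'M[C]_d) : support_lines theta -> unitary W -> density X ->
  \sum_j theta (dgc W X j) <= reg theta X.
Proof.
move=> st uW dX; have [U [lam dU]] := spectral_hermitian (proj1 (proj1 dX)).
by rewrite (reg_eig st dX dU); apply: peierls dU.
Qed.

Definition ip d (A B : 'M[C]_d) : R := Re (\tr (A *m B)).

Lemma ip_eig d (U X : 'M[C]_d) lam : diagonalizes U lam X ->
  ip X X = \sum_k lam k ^+ 2.
Proof.
move=> [uU ->]; rewrite /ip -!mulmxA mxtrace_mulC !mulmxA -(mulmxA _ (adjmx U) U) unitaryC //.
rewrite mulmx1 -!mulmxA unitaryC // mulmx1 mulmx_diag mxtrace_diag Re_sum.
by apply: eq_bigr => k _; rewrite !mxE ReM /= mulr0 subr0 expr2.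
Qed.

(** * Real coordinates of Hermitian matrices *)

Section Coordinates.
Variable d : nat.
Local Notation J := ('I_d * 'I_d)%type.
Local Notation hoc := (@herm_of_coords R d).
Implicit Types (a c : J -> R).

Definition lin_fun (phi : (J -> R) -> R) := forall (k : R) a c,
  phi (fun b => k * a b + c b) = k * phi a + phi c.

Definition dlt (b : J) : J -> R := fun b' => (b' == b)%:R.

Lemma lin_fun_sum phi : lin_fun phi -> forall a, phi a = \sum_b a b * phi (dlt b).
Proof.
move=> lphi a; have phi0 : phi (fun=> 0) = 0.
  have := lphi (-1) (fun=> 0) (fun=> 0).
  have -> : (fun b : J => -1 * 0 + 0) = (fun=> 0 : R) by apply/funext => b; ring.
  by rewrite mulN1r addNr.
have main (s : seq J) : uniq s ->
    phi (fun b => if b \in s then a b else 0) = \sum_(b <- s) a b * phi (dlt b).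
  elim: s => [_|b s IH /= /andP[bs us]]; first by rewrite big_nil.
  rewrite big_cons -IH // -lphi; congr phi; apply/funext => b'.
  rewrite inE /dlt; case: eqP => [->|_] /=; first by rewrite (negbTE bs) mulr1 addr0.
  by rewrite mulr0 add0r.
rewrite -(main _ (index_enum_uniq _)); congr phi; apply/funext => b.
by rewrite mem_index_enum.
Qed.

Lemma herm_of_coords_lin (k : R) a c :
  hoc (fun b => k * a b + c b) = k%:C%C *: hoc a + hoc c.
Proof.
apply/matrixP => i j; rewrite !mxE; case: eqP => _; last case: ifP => _;
  by apply: complex_eq; rewrite ?ReD ?ImD ?ReM ?ImM /=; ring.
Qed.

Lemma hermitian_coords a : Defs.hermitian (hoc a).
Proof.
apply/matrixP => i j; rewrite adjmxE !mxE eq_sym; case: eqP => [->|/eqP ij].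
  by apply: complex_eq; rewrite /= ?oppr0.
case: ltngtP => [?|?|/val_inj e]; try by apply: complex_eq; rewrite /= ?opprK.
by rewrite e eqxx in ij.
Qed.

(* The coordinates of the Hermitian part of A, as the dual variables of an FTQL
   trajectory are not known a priori to be Hermitian. *)
Definition coords (A : 'M[C]_d) : J -> R := fun b =>
  if b.1 == b.2 then Re (A b.1 b.1)
  else if (b.1 < b.2)%N then (Re (A b.1 b.2) + Re (A b.2 b.1)) / 2
  else (Im (A b.2 b.1) - Im (A b.1 b.2)) / 2.

Lemma herm_of_coordsK : cancel hoc coords.
Proof.
move=> a; apply/funext => -[i j]; rewrite /coords /=.
case: eqP => [->|/eqP ij]; first by rewrite mxE eqxx.
rewrite !mxE (negbTE ij) eq_sym (negbTE ij).
by move: ij; rewrite -val_eqE /=; case: ltngtP => // _ _ /=; field.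
Qed.

Lemma coordsK A : Defs.hermitian A -> hoc (coords A) = A.
Proof.
move=> hA; have E i j : A i j = conjc (A j i) by rewrite -adjmxE hA.
have ER i j : Re (A i j) = Re (A j i) by rewrite E Re_conjc.
have EI i j : Im (A i j) = - Im (A j i) by rewrite E Im_conjc.
apply/matrixP => i j; rewrite !mxE /coords /=.
case: eqP => [->|/eqP ij].
  rewrite eqxx; apply: complex_eq => //=; have := EI j j; lra.
rewrite (eq_sym j i) (negbTE ij) /=.
have := ER i j; have := EI i j.
by case: ltngtP => [?|?|/val_inj e] /=; rewrite ?e ?eqxx in ij *;
  move=> e1 e2; apply: complex_eq => /=; lra.
Qed.

(** Each off-diagonal coordinate enters two matrix entries, hence its weight 2 in the trace
    pairing. *)
Definition wt (b : J) : R := if b.1 == b.2 then 1 else 2.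

Local Notation dot := (wdot wt).

(** [Y] is arbitrary: its anti-Hermitian part has a purely imaginary pairing with [A]. The summands
    agree only after adding those at (i, j) and (j, i), so twice the sums are compared. *)
Lemma ip_dot A Y : Defs.hermitian A -> ip A Y = dot (coords A) (coords Y).
Proof.
move=> hA; have E i j : A i j = conjc (A j i) by rewrite -adjmxE hA.
have ER i j : Re (A i j) = Re (A j i) by rewrite E Re_conjc.
have EI i j : Im (A i j) = - Im (A j i) by rewrite E Im_conjc.
pose F i j := Re (A i j * Y j i).
pose G i j := wt (i, j) * coords A (i, j) * coords Y (i, j).
have FG i j : F i j + F j i = G i j + G j i.
  rewrite /F /G /wt /coords /= !ReM; case: eqP => [->|/eqP ij].
    rewrite eqxx; have := EI j j => e; have -> : Im (A j j) = 0 by lra.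
    ring.
  rewrite eq_sym (negbTE ij) (ER j i) (EI j i).
  case: ltngtP => [?|?|/val_inj e]; rewrite ?e ?eqxx in ij *; by [field|].
have -> : ip A Y = \sum_i \sum_j F i j.
  rewrite /ip /mxtrace Re_sum; apply: eq_bigr => i _.
  by rewrite mxE Re_sum.
have -> : dot (coords A) (coords Y) = \sum_i \sum_j G i j.
  by rewrite /wdot pair_bigA /=; apply: eq_bigr => -[].
apply: (@mulfI _ 2); first by rewrite pnatr_eq0.
have D (H : 'I_d -> 'I_d -> R) : 2 * (\sum_i \sum_j H i j) = \sum_i \sum_j (H i j + H j i).
  rewrite mulr2n mulrDl mul1r {2}exchange_big -big_split /=.
  by apply: eq_bigr => i _; rewrite -big_split.
by rewrite !D; apply: eq_bigr => i _; apply: eq_bigr => j _.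
Qed.

Lemma qform_lin v : lin_fun (fun a => qform v (hoc a)).
Proof.
move=> k a c; rewrite /qform herm_of_coords_lin mulmxDr mulmxDl mxE ReD.
by rewrite -scalemxAr -scalemxAl mxE ReZ.
Qed.

Lemma dgc_lin W j : lin_fun (fun a => dgc W (hoc a) j).
Proof. by move=> k a c; rewrite !dgc_qform; apply: qform_lin. Qed.

Lemma tr_coords a : \tr (hoc a) = (\sum_i a (i, i))%:C%C.
Proof.
rewrite /mxtrace; under eq_bigr do rewrite mxE eqxx.
by rewrite -rmorph_sum.
Qed.

Definition densc a := density (hoc a).

Lemma densc_iff a : densc a <-> (forall v, 0 <= qform v (hoc a)) /\ \sum_i a (i, i) = 1.
Proof.
rewrite /densc /density tr_coords; split => [[[_ p] t]|[p t]].
  by split => //; have := congr1 Re t.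
by split; [split => //; exact: hermitian_coords|rewrite t].
Qed.

End Coordinates.
End Hermitian.

(** * Maximizers of strongly concave objectives *)

Section StronglyConvex.
Variables (R : realType) (J : finType) (w : J -> R).
Hypothesis w1 : forall b, 1 <= w b.
Local Notation dot := (wdot w).
Implicit Types (a c x y : J -> R).

Definition diffc a c : J -> R := fun b => a b - c b.
Definition midc a c : J -> R := fun b => (a b + c b) / 2.

Lemma cvg_fin_sum (K : finType) (T : Type) (F : set_system T) (f : K -> T -> R) (l : K -> R) :
  Filter F -> (forall k, f k t @[t --> F] --> l k) ->
  (\sum_k f k t) @[t --> F] --> \sum_k l k.
Proof. by move=> FF fl; apply: cvg_big => [|k _]; [exact: add_continuous|exact: fl]. Qed.

Lemma wdotBl a a' c : dot (diffc a a') c = dot a c - dot a' c.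
Proof. by rewrite /wdot -sumrB; apply: eq_bigr => b _; rewrite /diffc; ring. Qed.

Lemma wdotBr a c c' : dot a (diffc c c') = dot a c - dot a c'.
Proof. by rewrite /wdot -sumrB; apply: eq_bigr => b _; rewrite /diffc; ring. Qed.

Lemma wdotC a c : dot a c = dot c a.
Proof. by rewrite /wdot; apply: eq_bigr => b _; ring. Qed.

Lemma wdot_midr y a c : dot y (midc a c) = (dot y a + dot y c) / 2.
Proof.
by rewrite /wdot -big_split mulr_suml; apply: eq_bigr => b _; rewrite /midc /=; field.
Qed.

Lemma wdot_parallelogram a c : dot (midc a c) (midc a c) =
  (dot a a + dot c c) / 2 - dot (diffc a c) (diffc a c) / 4.
Proof.
rewrite /wdot -big_split !mulr_suml -sumrB; apply: eq_bigr => b _.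
by rewrite /midc /diffc /=; field.
Qed.

Lemma w_ge0 b : 0 <= w b. Proof. exact: le_trans (w1 b). Qed.

Lemma wdot_ge0 a : 0 <= dot a a.
Proof. by apply: sumr_ge0 => b _; rewrite -mulrA mulr_ge0 ?w_ge0 // -expr2 sqr_ge0. Qed.

Lemma sqr_le_wdot a b : a b ^+ 2 <= dot a a.
Proof.
rewrite /wdot (bigD1 b) //=; apply: ler_wpDr.
  by apply: sumr_ge0 => b' _; rewrite -mulrA mulr_ge0 ?w_ge0 // -expr2 sqr_ge0.
by rewrite -mulrA -expr2 ler_peMl ?sqr_ge0.
Qed.

Variables (D : set (J -> R)) (h : (J -> R) -> R) (kappa : R).
Hypothesis kappa0 : 0 < kappa.

(** A maximizer with quadratic growth of the loss, the form in which strong convexity is passed on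
    to the dynamics. *)
Definition strong_argmax y q := D q /\ forall x, D x ->
  dot y x - h x + kappa * dot (diffc q x) (diffc q x) <= dot y q - h q.

(** Test each maximizer against the other and add. *)
Lemma strong_argmax_mono y y' q q' : strong_argmax y q -> strong_argmax y' q' ->
  2 * kappa * dot (diffc q q') (diffc q q') <= dot (diffc y y') (diffc q q').
Proof.
move=> [Dq mq] [Dq' mq']; have := mq _ Dq'; have := mq' _ Dq.
have -> : dot (diffc q' q) (diffc q' q) = dot (diffc q q') (diffc q q').
  by apply: eq_bigr => b _; rewrite /diffc; ring.
rewrite !wdotBl !wdotBr; lra.
Qed.

(** Monotonicity and Young's inequality bound the weighted square norm of q - q' by W (e / kappa)^2,
    and W >= 1 allows W^2 in place of W. *)
Lemma strong_argmax_lip y y' q q' e : strong_argmax y q -> strong_argmax y' q' ->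
  close e y y' -> close ((\sum_b w b) / kappa * e) q q'.
Proof.
move=> mq mq' c b; set W := \sum_b w b.
have W0 : 0 <= W by apply: sumr_ge0 => b' _; exact: w_ge0.
have e0 : 0 <= e by apply: le_trans (c b); exact: normr_ge0.
set d := diffc q q'.
have W1 : 1 <= W.
  apply: le_trans (w1 b) _; rewrite /W (bigD1 b) //= lerDl.
  by apply: sumr_ge0 => b' _; exact: w_ge0.
have : kappa * dot d d <= W * (e ^+ 2 / kappa).
  have := strong_argmax_mono mq mq'; rewrite -/d => mono.
  suff : dot (diffc y y') d <= kappa * dot d d + W * (e ^+ 2 / kappa) by lra.
  rewrite /wdot mulr_sumr /W mulr_suml -big_split; apply: ler_sum => b' _ /=.
  have -> : kappa * (w b' * d b' * d b') + w b' * (e ^+ 2 / kappa) =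
    w b' * (kappa * d b' ^+ 2 + e ^+ 2 / kappa) by ring.
  rewrite -mulrA ler_wpM2l ?w_ge0 //.
  apply: (@le_trans _ _ (e * `|d b'|)).
    by apply: le_trans (ler_norm _) _; rewrite normrM ler_wpM2r // c.
  have -> : kappa * d b' ^+ 2 + e ^+ 2 / kappa = ((kappa * `|d b'|) ^+ 2 + e ^+ 2) / kappa.
    by rewrite exprMn real_normK ?num_real //; field; rewrite gt_eqF.
  rewrite ler_pdivlMr //; have := sqr_ge0 (kappa * `|d b'| - e).
  have : 0 <= kappa * `|d b'| * e by rewrite !mulr_ge0 // ltW.
  by rewrite sqrrB; lra.
rewrite -ler_pdivlMl // => dd.
have d2 : `|d b| ^+ 2 <= (W / kappa * e) ^+ 2.
  rewrite real_normK ?num_real //; apply: le_trans (sqr_le_wdot d b) _.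
  apply: le_trans dd _; rewrite -subr_ge0.
  have -> : (W / kappa * e) ^+ 2 - kappa^-1 * (W * (e ^+ 2 / kappa)) =
    W * (W - 1) * (e / kappa) ^+ 2 by field; rewrite gt_eqF.
  by rewrite mulr_ge0 ?sqr_ge0 // mulr_ge0 // subr_ge0.
by move: d2; rewrite ler_pXn2r // ?nnegrE // !mulr_ge0 // invr_ge0 ltW.
Qed.

Hypothesis D0 : exists x0, D x0.
Hypothesis Dbd : forall a b, D a -> `|a b| <= 1.
Hypothesis Dmid : forall a c, D a -> D c -> D (midc a c).
Hypothesis hmid : forall a c, D a -> D c ->
  h (midc a c) + kappa / 2 * dot (diffc a c) (diffc a c) <= (h a + h c) / 2.
Hypothesis hlow : exists m, forall a, D a -> m <= h a.
Hypothesis Dlim : forall (s : nat -> J -> R) a, (forall n, D (s n)) ->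
  (forall b, s n b @[n --> \oo] --> a b) ->
  D a /\ forall e : R, 0 < e -> \forall n \near \oo, h a <= h (s n) + e.

Lemma wdot_cvg y (s : nat -> J -> R) a : (forall b, s n b @[n --> \oo] --> a b) ->
  dot y (s n) @[n --> \oo] --> dot y a.
Proof. by move=> sa; apply: cvg_fin_sum => b; apply: cvgMr; exact: sa. Qed.

(* A maximizing sequence is Cauchy by strong convexity. *)
Lemma argmax_exists y : exists2 q, D q & forall x, D x -> dot y x - h x <= dot y q - h q.
Proof.
pose F x := dot y x - h x; have [x0 Dx0] := D0; have [m mP] := hlow.
pose S := [set F x | x in D].
have supS : has_sup S.
  split; first by exists (F x0), x0.
  exists (\sum_b w b * `|y b| - m) => _ [x Dx <-]; rewrite lerB ?mP //.
  apply: ler_sum => b _; rewrite -mulrA ler_wpM2l ?w_ge0 //.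
  by apply: le_trans (ler_norm _) _; rewrite normrM ler_piMr // Dbd.
have Sle x : D x -> F x <= sup S.
  by move=> Dx; apply: ub_le_sup; [case: supS|exists x].
have : forall n : nat, exists x, D x /\ sup S - n.+1%:R^-1 < F x.
  move=> n; have n0 : 0 < n.+1%:R^-1 :> R by rewrite invr_gt0.
  have [_ [x Dx <-] ltx] := sup_adherent n0 supS.
  by exists x.
move=> /choice[s sP].
(* Two almost maximizers that are far apart would have a midpoint exceeding the supremum. *)
have gap N n k : (N <= n)%N -> (N <= k)%N ->
    kappa / 2 * dot (diffc (s n) (s k)) (diffc (s n) (s k)) <= N.+1%:R^-1.
  move=> Nn Nk; have [Dn sn] := sP n; have [Dk sk] := sP k.
  have := Sle _ (Dmid Dn Dk); rewrite /F wdot_midr.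
  have := hmid Dn Dk; rewrite /F in sn sk.
  have inv j : (N <= j)%N -> j.+1%:R^-1 <= N.+1%:R^-1 :> R.
    by move=> Nj; rewrite lef_pV2 ?posrE ?ltr0Sn // ler_nat ltnS.
  move: sn sk (inv _ Nn) (inv _ Nk).
  set u := n.+1%:R^-1; set v := k.+1%:R^-1; set t := N.+1%:R^-1; set S' := sup S; lra.
have cau b : cvg (s n b @[n --> \oo]).
  apply: R_complete; apply: cauchy_exP => e e0.
  have k2 : 0 < kappa / 2 by rewrite divr_gt0.
  have d0 : 0 < kappa / 2 * e ^+ 2 by rewrite mulr_gt0 // exprn_gt0.
  have [N NP] := div_small 1 d0; exists (s N.+1 b).
  exists N.+1 => // n /= Nn.
  have N2 : 1 / N.+2%:R < kappa / 2 * e ^+ 2.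
    by apply: lt_le_trans NP; rewrite ltr_pM2l // ltf_pV2 ?posrE ?ltr0Sn // ltr_nat.
  rewrite div1r in N2; have := gap N.+1 _ _ (leqnn _) Nn; move=> /le_lt_trans/(_ N2).
  rewrite ltr_pM2l // => /(le_lt_trans (sqr_le_wdot _ b)).
  rewrite -[diffc _ _ b ^+ 2]real_normK ?num_real // ltr_pXn2r // nnegrE //.
  exact: ltW.
pose a b := lim (s n b @[n --> \oo]).
have sa b : s n b @[n --> \oo] --> a b by exact: cau.
have [Da ha] := Dlim (fun n => (sP n).1) sa.
exists a => // x Dx; apply: le_trans (Sle x Dx) _.
apply/ler_addgt0Pr => e e0; have e3 : 0 < e / 3 by rewrite divr_gt0.
have ya := wdot_cvg (y := y) sa.
near \oo => n.
have h1 : h a <= h (s n) + e / 3 by near: n; apply: ha.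
have h2 : `|dot y a - dot y (s n)| < e / 3.
  by near: n; move/cvgrPdist_lt: ya; apply.
have h3 : n.+1%:R^-1 < e / 3.
  by near: n; apply: (near_infty_natSinv_lt (PosNum e3)).
have [_] := sP n; rewrite /F => h4.
move: h1 h2 h3 h4; rewrite ltr_norml => + /andP[+ _].
by set u := n.+1%:R^-1; set S' := sup S; lra.
Unshelve. all: by end_near.
Qed.

(** Compare [q] with its midpoint with [x]. *)
Lemma strong_argmaxP y q : D q -> (forall x, D x -> dot y x - h x <= dot y q - h q) ->
  strong_argmax y q.
Proof.
move=> Dq mq; split => // x Dx; have := mq _ (Dmid Dq Dx); have := hmid Dq Dx.
rewrite wdot_midr; lra.
Qed.

End StronglyConvex.

Lemma midpoint_arith (R : realFieldType) (k A B X u v r s t : R) :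
  A <= u - k / 2 * r -> B <= v - k / 2 * s -> X <= (A + B) / 2 ->
  X + k / 2 * ((r + s) / 2 - t / 4) + k / 4 / 2 * t <= (u + v) / 2.
Proof. lra. Qed.

(** * The regularizer and the mirror map of one player *)

Section Player.
Variables (R : realType) (d : nat) (theta : R -> R).
Hypothesis d0 : (0 < d)%N.
Hypothesis adm : admissible_theta theta.
Local Notation C := R[i].
Local Notation J := ('I_d * 'I_d)%type.
Local Notation hoc := (@herm_of_coords R d).
Local Notation dot := (wdot (@wt R d)).
Local Notation dens := (@densc R d).
Implicit Types (a c x y : J -> R).

Definition regc a := reg theta (hoc a).
Definition mirrorc y := coords (mirror theta (hoc y)).

Lemma wt_ge1 b : 1 <= @wt R d b.
Proof. by rewrite /wt; case: ifP; rewrite // ler1n. Qed.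

Lemma lin_fun_mid phi a c : lin_fun phi -> phi (midc a c) = (phi a + phi c) / 2.
Proof.
move=> lphi; rewrite !(lin_fun_sum lphi) -big_split mulr_suml.
by apply: eq_bigr => b _; rewrite /midc /=; field.
Qed.

Lemma lin_fun_cvg (phi : (J -> R) -> R) (s : nat -> J -> R) a : lin_fun phi ->
  (forall b, s n b @[n --> \oo] --> a b) -> phi (s n) @[n --> \oo] --> phi a.
Proof.
move=> lphi sa; rewrite (lin_fun_sum lphi a).
have -> : (fun n => phi (s n)) = (fun n => \sum_b s n b * phi (dlt R b)).
  by apply/funext => n; rewrite (lin_fun_sum lphi).
by apply: cvg_fin_sum => b; apply: cvgMl; exact: sa.
Qed.

Lemma ip_coords a c : ip (hoc a) (hoc c) = dot a c.
Proof. by rewrite ip_dot ?herm_of_coordsK //; exact: hermitian_coords. Qed.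

Lemma trace_lin : lin_fun (fun a : J -> R => \sum_i a (i, i)).
Proof. by move=> k a c; rewrite mulr_sumr -big_split. Qed.

Lemma dens_mid a c : dens a -> dens c -> dens (midc a c).
Proof.
move=> /densc_iff[pa ta] /densc_iff[pc tc]; apply/densc_iff; split=> [v|].
  rewrite (lin_fun_mid _ _ (@qform_lin R d v)) divr_ge0 // addr_ge0 //.
have := lin_fun_mid a c trace_lin; rewrite /= ta tc => ->.
by rewrite -mulr2n -mulr_natl mulr1 divff.
Qed.

(** The weighted squares of the coordinates add up to tr X^2, which is at most tr X = 1. *)
Lemma dens_bound a b : dens a -> `|a b| <= 1.
Proof.
move=> da; have [U [lam dU]] := spectral_hermitian (proj1 (proj1 da)).
have lam01 j := density_eig j dU da.
have : a b ^+ 2 <= 1.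
  apply: le_trans (sqr_le_wdot wt_ge1 a b) _; rewrite -ip_coords (ip_eig dU).
  have <- : \sum_k lam k = 1.
    rewrite -(eq_bigr _ (fun k _ => dgc_diag dU k)) dgc_sum; last by case: dU.
    by rewrite (proj2 da).
  apply: ler_sum => k _; rewrite expr2 ler_piMr //; by case/andP: (lam01 k).
by move=> a1; rewrite -(@ler_pXn2r _ 2) ?nnegrE // expr1n real_normK // num_real.
Qed.

Lemma support_theta : support_lines theta.
Proof.
have [c c0 q] := admissible_quadratic adm; move=> a a01; exists (derive1 theta a) => x x01.
by apply: le_trans (q a x a01 x01); rewrite lerDl mulr_ge0 ?sqr_ge0 // divr_ge0 // ltW.
Qed.

(** With g = theta - k/2 x^2 still convex, the regularizer is the sum of g over the eigenvalues plus
    k/2 times the squared norm. In an eigenbasis of the midpoint, [peierls] and scalar convexity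
    handle g; the parallelogram identity gives the gain k/8, so kappa = k/4. *)
Lemma regc_mid : exists2 kappa : R, 0 < kappa & forall a c, dens a -> dens c ->
  regc (midc a c) + kappa / 2 * dot (diffc a c) (diffc a c) <= (regc a + regc c) / 2.
Proof.
have [k k0 q] := admissible_quadratic adm; exists (k / 4); first by rewrite divr_gt0.
move=> a c da dc; have dm := dens_mid da dc.
have [U [lam dU]] := spectral_hermitian (proj1 (proj1 dm)).
pose g (x : R) := theta x - k / 2 * x ^+ 2; have sg : support_lines g := support_quadratic q.
have reg_g x V mu : dens x -> diagonalizes V mu (hoc x) ->
    regc x = \sum_j g (mu j) + k / 2 * dot x x.
  move=> dx dV; rewrite /regc (reg_eig support_theta dx dV) -ip_coords (ip_eig dV).
  by rewrite mulr_sumr -big_split; apply: eq_bigr => j _; rewrite /g /=; ring.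
have reg_g_ge x : dens x -> \sum_j g (dgc U (hoc x) j) <= regc x - k / 2 * dot x x.
  move=> dx; have [V [mu dV]] := spectral_hermitian (proj1 (proj1 dx)).
  by rewrite (reg_g _ _ _ dx dV) addrK; apply: peierls dV => //; case: dU.
have avg : \sum_j g (lam j) <=
    (\sum_j g (dgc U (hoc a) j) + \sum_j g (dgc U (hoc c) j)) / 2.
  rewrite -big_split mulr_suml; apply: ler_sum => j _ /=.
  rewrite -(dgc_diag dU) (lin_fun_mid _ _ (@dgc_lin R d U j)).
  by apply: support_mid => //; apply: density_dgc => //; case: dU.
rewrite (reg_g _ _ _ dm dU) wdot_parallelogram.
exact: midpoint_arith (reg_g_ge _ da) (reg_g_ge _ dc) avg.
Qed.

Lemma regc_low : exists m : R, forall a, dens a -> m <= regc a.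
Proof.
have [m mP] := support_lower support_theta; exists (\sum_(j < d) m) => a da.
have [U [lam dU]] := spectral_hermitian (proj1 (proj1 da)).
rewrite /regc (reg_eig support_theta da dU); apply: ler_sum => j _.
by apply: mP; apply: density_eig dU da.
Qed.

(** For semicontinuity, fix an eigenbasis of the limit. The diagonals in it converge, [reg_ge]
    bounds the regularizer of [s n] below by their [theta]-sum, and at the limit this bound is an
    equality. No continuity of eigenvalues enters. *)
Lemma dens_limit (s : nat -> J -> R) a : (forall n, dens (s n)) ->
  (forall b, s n b @[n --> \oo] --> a b) ->
  dens a /\ forall e : R, 0 < e -> \forall n \near \oo, regc a <= regc (s n) + e.
Proof.
move=> ds sa; have da : dens a.
  apply/densc_iff; split=> [v|].
    apply: (cvgr_to_ge (lin_fun_cvg (@qform_lin R d v) sa)).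
    by near=> n; have /densc_iff[] := ds n.
  have tc := lin_fun_cvg trace_lin sa.
  have s1 n : \sum_i s n (i, i) = 1 by have /densc_iff[] := ds n.
  apply/eqP; rewrite eq_le; apply/andP; split.
    by apply: (cvgr_to_le tc); near=> n; rewrite s1.
  by apply: (cvgr_to_ge tc); near=> n; rewrite s1.
split => // e e0; have [U [lam dU]] := spectral_hermitian (proj1 (proj1 da)).
have uU : unitary U by case: dU.
have e' : 0 < e / d%:R by rewrite divr_gt0 // ltr0n.
have near_j j : \forall n \near \oo, theta (dgc U (hoc a) j) <=
    theta (dgc U (hoc (s n)) j) + e / d%:R.
  have [ct _ _ _ _] := adm.
  have [r r0 rP] := within_unit_eps ct (density_dgc j uU da) e'.
  have := lin_fun_cvg (@dgc_lin R d U j) sa; move/cvgrPdist_lt => /(_ r r0).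
  apply: filterS => n /(rP _ (density_dgc j uU (ds n))).
  rewrite ltr_norml => /andP[_]; lra.
near=> n; have nP j : theta (dgc U (hoc a) j) <=
    theta (dgc U (hoc (s n)) j) + e / d%:R.
  by move: j; near: n; exact: filter_forall near_j.
rewrite /regc (reg_eig support_theta da dU).
apply: le_trans (lerD (reg_ge support_theta uU (ds n)) (lexx e)).
have -> : e = \sum_(j < d) e / d%:R.
  by rewrite sumr_const card_ord -[(_ / _) *+ d]mulr_natr divfK // pnatr_eq0 -lt0n.
rewrite -big_split; apply: ler_sum => j _; rewrite -(dgc_diag dU); exact: nP.
Unshelve. all: by end_near.
Qed.

Lemma dens_exists : exists a, dens a.
Proof.
exists (fun b => if b.1 == b.2 then d%:R^-1 else 0); apply/densc_iff.
split=> [v|]; last first.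
  rewrite /= (eq_bigr (fun=> d%:R^-1)); last by move=> i _; rewrite eqxx.
  by rewrite sumr_const card_ord -[_ *+ d]mulr_natl mulfV // pnatr_eq0 -lt0n.
have -> : hoc (fun b => if b.1 == b.2 then d%:R^-1 else 0) = (d%:R^-1)%:C%C%:M.
  apply/matrixP => i j; rewrite !mxE /=; case: eqP => [->|/eqP ij].
    by rewrite eqxx mulr1n.
  rewrite (eq_sym j i) (negbTE ij) mulr0n.
  by case: ifP => _; apply: complex_eq; rewrite /= ?oppr0.
rewrite /qform -scalemx1 -scalemxAr mulmx1 -scalemxAl mxE ReZ mulr_ge0 ?invr_ge0 //.
rewrite mxE Re_sum; apply: sumr_ge0 => j _; rewrite adjmxE ReM Re_conjc Im_conjc.
by rewrite mulNr opprK addr_ge0 // -expr2 sqr_ge0.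
Qed.

(** Since a maximizer exists, the [xget] in [mirror] does not return its default 0. *)
Lemma mirrorP : exists2 kappa : R, 0 < kappa &
  forall y, strong_argmax (@wt R d) dens regc kappa y (mirrorc y) /\
    hoc (mirrorc y) = mirror theta (hoc y).
Proof.
have [kappa k0 hmid] := regc_mid; exists kappa => // y.
have [q Dq mq] := argmax_exists wt_ge1 k0 dens_exists dens_bound dens_mid hmid
  regc_low dens_limit y.
have [dm mm] : density (mirror theta (hoc y)) /\
   forall X', density X' -> complex.Re (\tr (hoc y *m X')) - reg theta X' <=
     complex.Re (\tr (hoc y *m mirror theta (hoc y))) - reg theta (mirror theta (hoc y)).
  rewrite /mirror; set S := [set X | _]; apply: (@xgetPex _ 0 S).
  exists (hoc q); split => // X' dX'.
  have X'E : hoc (coords X') = X' by apply: coordsK; case: dX' => [[]].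
  have := mq (coords X'); rewrite -!ip_coords /regc /densc X'E => mqX; exact: mqX.
have mE : hoc (mirrorc y) = mirror theta (hoc y) by apply: coordsK; case: dm => [[]].
split => //; apply: (strong_argmaxP dens_mid hmid); first by rewrite /densc mE.
by move=> x dx; rewrite -!ip_coords /regc mE; apply: mm.
Qed.

Lemma qform_eig (U X : 'M[C]_d) lam v : diagonalizes U lam X ->
  exists2 s : 'I_d -> R, forall k, 0 <= s k &
    qform v X = \sum_k lam k * s k /\ \sum_k s k = qform v 1%:M.
Proof.
move=> [uU ->]; pose u := adjmx U *m v.
have uE : adjmx v *m U = adjmx u by rewrite /u adjmxM adjmxK.
exists (fun k => complex.Re (u k 0) ^+ 2 + complex.Im (u k 0) ^+ 2).
  by move=> k; rewrite addr_ge0 // sqr_ge0.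
split.
  rewrite /qform !mulmxA uE -mulmxA -/u mul_mx_diag [X in complex.Re X]mxE Re_sum.
  apply: eq_bigr => k _; rewrite [X in X * _]mxE [(\row_j _) _ _]mxE adjmxE.
  by rewrite !ReM !ImM Re_conjc Im_conjc /=; ring.
have -> : qform v 1%:M = complex.Re ((adjmx u *m u) 0 0).
  by rewrite /qform -uU -uE /u !mulmxA.
rewrite mxE Re_sum; apply: eq_bigr => k _.
by rewrite adjmxE !ReM Re_conjc Im_conjc; ring.
Qed.

(** The eigenvalues of [Xs] are at least some l > 0 and those of [e] at least -m, so r = l / (m + 1)
    keeps the sum positive; [e] is traceless, so the trace stays 1. *)
Lemma dens_interior (Xs : 'M[C]_d) e : density Xs -> pdef Xs ->
  \sum_i e (i, i) = 0 -> exists2 r : R, 0 < r &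
  dens (fun b => r * e b + coords Xs b).
Proof.
move=> dX pX te; have hX : Defs.hermitian Xs by case: pX.
have XE : hoc (coords Xs) = Xs by apply: coordsK.
have [U [lam dU]] := spectral_hermitian hX; have uU : unitary U by case: dU.
have lam0 k : 0 < lam k.
  rewrite -(dgc_diag dU) dgc_qform; apply: (proj2 pX); apply/eqP => u0.
  have /matrixP/(_ k k) := unitaryC uU; rewrite !mxE eqxx big1 => [/eqP|j _].
    by rewrite eq_sym oner_eq0.
  have /matrixP/(_ j 0) := u0; rewrite !mxE => ->; by rewrite mulr0.
(* A positive lower bound for all eigenvalues that avoids taking a minimum. *)
pose l := (\sum_k (lam k)^-1)^-1.
have S0 : 0 < \sum_k (lam k)^-1.
  rewrite (bigD1 (Ordinal d0)) //=; apply: ltr_wpDr; last by rewrite invr_gt0.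
  by apply: sumr_ge0 => k _; rewrite invr_ge0 ltW.
have l0 : 0 < l by rewrite invr_gt0.
have lle k : l <= lam k.
  rewrite -[lam k]invrK lef_pV2 ?posrE ?invr_gt0 // (bigD1 k) //= lerDl.
  by apply: sumr_ge0 => j _; rewrite invr_ge0 ltW.
have [V [mu dV]] := spectral_hermitian (hermitian_coords e).
pose m := \sum_k `|mu k|; have m0 : 0 <= m by apply: sumr_ge0.
have m1 : 0 < m + 1 by rewrite ltr_wpDl.
have mle k : - m <= mu k.
  rewrite lerNl (le_trans (ler_norm _)) // normrN /m (bigD1 k) //= lerDl.
  by apply: sumr_ge0.
exists (l / (m + 1)); first by rewrite divr_gt0.
apply/densc_iff; split=> [v|]; last first.
  by have := trace_lin (l / (m + 1)) e (coords Xs); rewrite te mulr0 add0r => ->;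
    have := proj2 dX; rewrite -{1}XE tr_coords => /(congr1 (@complex.Re R)).
have -> := @qform_lin R d v (l / (m + 1)) e (coords Xs); rewrite XE.
have [s s0 [-> sE]] := qform_eig v dU; have [t t0 [-> tE]] := qform_eig v dV.
have n0 : 0 <= qform v 1%:M by rewrite -sE sumr_ge0.
have B1 : l * qform v 1%:M <= \sum_k lam k * s k.
  by rewrite -sE mulr_sumr; apply: ler_sum => k _; rewrite ler_wpM2r.
have B2 : - m * qform v 1%:M <= \sum_k mu k * t k.
  by rewrite -tE mulr_sumr; apply: ler_sum => k _; rewrite ler_wpM2r.
have lm : 0 <= l / (m + 1) by rewrite divr_ge0 // ltW.
apply: le_trans (lerD (ler_wpM2l lm B2) B1).
have -> : l / (m + 1) * (- m * qform v 1%:M) + l * qform v 1%:M =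
  l / (m + 1) * qform v 1%:M by field; rewrite gt_eqF.
by rewrite mulr_ge0.
Qed.

End Player.

(** * Energy and recurrence *)

Section Side.
Variables (R : realType) (J K : finType) (w : J -> R) (m : J -> K -> R).
Hypothesis w_ge1 : forall b, 1 <= w b.
Variables (D : set (J -> R)) (h : (J -> R) -> R) (kappa : R) (q : (J -> R) -> J -> R).
Hypothesis kappa0 : 0 < kappa.
Hypothesis qP : forall y, strong_argmax w D h kappa y (q y).
(** In the application [one] holds the coordinates of the identity matrix, [o] is a diagonal
    position and [xs] is the equilibrium strategy. *)
Variables (one : J -> R) (o : J) (xs : J -> R).
Hypothesis one_o : one o = 1.
Local Notation dot := (wdot w).
Hypothesis D_one : forall x, D x -> dot one x = 1.
Hypothesis Dxs : D xs.
Hypothesis xs_interior : forall e, dot one e = 0 ->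
  exists2 r : R, 0 < r & D (fun b => r * e b + xs b).

Definition bil (a : J -> R) (x : K -> R) := \sum_b \sum_k a b * m b k * x k.

(** The gradient of [bil] for the weighted pairing, hence the division by the weight. *)
Definition grad (x : K -> R) b := (\sum_k m b k * x k) / w b.

(* The gradient modulo the direction [one], along which mirror maps are
   constant; the representative has a vanishing [o] coordinate. *)
Definition rgrad x b := grad x b - one b * grad x o.

Let wn0 b : w b != 0. Proof. by rewrite gt_eqF // (lt_le_trans _ (w_ge1 b)). Qed.

Lemma wdotBZl (n : J -> R) (a : J -> R) c : dot (fun b => n b - a b * c) =1
  (fun x => dot n x - c * dot a x).
Proof.
move=> x; rewrite /wdot mulr_sumr -sumrB; apply: eq_bigr => b _; ring.
Qed.

Lemma wdot_grad x e : dot (grad x) e = bil e x.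
Proof.
apply: eq_bigr => b _; rewrite /grad mulrCA divff // mulr1 mulr_suml.
by apply: eq_bigr => k _; ring.
Qed.

Lemma rgrad_bil x e : dot one e = 0 -> dot (rgrad x) e = bil e x.
Proof. by move=> oe; rewrite /rgrad wdotBZl oe mulr0 subr0 wdot_grad. Qed.

Lemma rgrad_o x : rgrad x o = 0.
Proof. by rewrite /rgrad one_o mul1r subrr. Qed.

Definition rnorm := \sum_b \sum_k `|m b k / w b - one b * (m o k / w o)|.

Lemma rgradE x b : rgrad x b = \sum_k (m b k / w b - one b * (m o k / w o)) * x k.
Proof.
rewrite /rgrad /grad !mulr_suml mulr_sumr -sumrB; apply: eq_bigr => k _; ring.
Qed.

Lemma rgrad_le x b (e : R) : 0 <= e -> (forall k, `|x k| <= e) ->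
  `|rgrad x b| <= rnorm * e.
Proof.
move=> e0 xe; rewrite rgradE; apply: le_trans (ler_norm_sum _ _ _) _.
rewrite /rnorm (bigD1 b) //= mulrDl; apply: ler_wpDr.
  by rewrite mulr_ge0 // sumr_ge0 // => b' _; rewrite sumr_ge0.
by rewrite mulr_suml; apply: ler_sum => k _; rewrite normrM ler_wpM2l.
Qed.

Lemma rnorm_ge0 : 0 <= rnorm.
Proof. by apply: sumr_ge0 => b _; apply: sumr_ge0. Qed.

Lemma rgradB x x' b : rgrad x b - rgrad x' b = rgrad (diffc x x') b.
Proof.
by rewrite !rgradE -sumrB; apply: eq_bigr => k _; rewrite /diffc; ring.
Qed.

(** Pairing with [one] is constant on [D], so the right-hand side of [strong_argmax_mono]
    vanishes. *)
Lemma mirror_shift y c : q (fun b => y b + c * one b) = q y.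
Proof.
set y' := fun b => _; have := strong_argmax_mono (qP y') (qP y).
have -> : dot (diffc y' y) (diffc (q y') (q y)) = c * dot one (diffc (q y') (q y)).
  by rewrite /wdot mulr_sumr; apply: eq_bigr => b _; rewrite /diffc /y'; ring.
have [[Dq' _] [Dq _]] := (qP y', qP y).
rewrite [dot one _]wdotBr !D_one // subrr mulr0 => le0; apply/funext => b.
have : diffc (q y') (q y) b ^+ 2 <= 0.
  apply: le_trans (sqr_le_wdot w_ge1 _ b) _.
  by rewrite -(@pmulr_rle0 _ (2 * kappa)) // mulr_gt0.
by rewrite le_eqVlt ltNge sqr_ge0 orbF sqrf_eq0 subr_eq0 => /eqP.
Qed.

(* The Fenchel coupling with [xs], up to the constant [h xs]. *)
Definition coupling y := dot y (q y) - h (q y) - dot y xs.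

Lemma coupling_ge y x : D x -> dot y (diffc x xs) - h x <= coupling y.
Proof.
move=> Dx; have [_ /(_ x Dx)] := qP y; rewrite /coupling [dot y (diffc x xs)]wdotBr.
have : 0 <= kappa * dot (diffc (q y) x) (diffc (q y) x).
  by rewrite mulr_ge0 ?wdot_ge0 // ltW.
lra.
Qed.

(** Subgradient inequality of the convex function [coupling] at the endpoint [y']: test the
    maximality of [q y] against [q y']. *)
Lemma coupling_diff y y' :
  coupling y' - coupling y <= dot (diffc y' y) (diffc (q y') xs).
Proof.
have [Dq' _] := qP y'; have := coupling_ge y Dq'.
rewrite /coupling wdotBl !wdotBr; lra.
Qed.

Lemma coupling_low y : - h xs <= coupling y.
Proof. by have := coupling_ge y Dxs; rewrite wdotBr subrr add0r. Qed.

(** The bound [coupling_ge] at the point r e + xs, which interiority places in [D]. *)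
Lemma coupling_direction k e : dot one e = 0 ->
  exists C : R, forall y, coupling y <= k -> dot y e <= C.
Proof.
move=> /xs_interior[r r0 Dx]; exists ((k + h (fun b => r * e b + xs b)) / r) => y yk.
rewrite ler_pdivlMr //; have := le_trans (coupling_ge y Dx) yk.
have -> : dot y (diffc (fun b => r * e b + xs b) xs) = dot y e * r.
  by rewrite /wdot mulr_suml; apply: eq_bigr => b _; rewrite /diffc; ring.
lra.
Qed.

Lemma coupling_coercive k c : exists C : R, forall y, coupling y <= k -> y o = c ->
  forall b, `|y b| <= C.
Proof.
(* Pairing with this direction extracts s (y b - one b y o), which vanishes on [one]. The signs s =
   1 and s = -1 bound [y b] on both sides once [y o] is fixed. *)
pose e s b : J -> R := fun b' => s * ((b' == b)%:R / w b - one b * ((b' == o)%:R / w o)).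
have dote s b y : dot y (e s b) = s * (y b - one b * y o).
  have D1 b0 : \sum_b' w b' * y b' * ((b' == b0)%:R / w b0) = y b0.
    rewrite (bigD1 b0) //= eqxx big1 => [|b' /negbTE->].
      by rewrite addr0 /=; field; rewrite wn0.
    by rewrite mul0r mulr0.
  rewrite -[in RHS](D1 b) -[in RHS](D1 o) mulrBr !mulr_sumr -sumrB.
  by apply: eq_bigr => b' _; rewrite /e; ring.
have : forall b, exists C : R, forall y, coupling y <= k -> y o = c -> `|y b| <= C.
  move=> b; have oe s : dot one (e s b) = 0 by rewrite dote one_o mulr1 subrr mulr0.
  have [C1 C1P] := coupling_direction k (oe 1).
  have [C2 C2P] := coupling_direction k (oe (-1)).
  exists (`|C1| + `|C2| + `|one b * c|) => y yk yo.
  have := C1P y yk; have := C2P y yk; rewrite !dote yo.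
  have := ler_norm C1; have := ler_norm C2; have := normr_ge0 C1; have := normr_ge0 C2.
  have := ler_norm (one b * c); have := ler_norm (- (one b * c)); rewrite normrN ler_norml.
  by move=> *; apply/andP; split; lra.
move=> /choice[C CP]; exists (\sum_b `|C b|) => y yk yo b.
apply: le_trans (CP b y yk yo) _; apply: le_trans (ler_norm _) _.
by rewrite (bigD1 b) //= lerDl sumr_ge0.
Qed.

End Side.

(** Over n equal steps the total increase is at most C t^2 / n. This replaces differentiating the
    energy. *)
Lemma nonincreasing_of_quadratic (R : realType) (g : R -> R) (C : R) : 0 <= C ->
  (forall t s, 0 <= t -> 0 < s -> g (t + s) <= g t + C * s ^+ 2) ->
  forall t, 0 <= t -> g t <= g 0.
Proof.
move=> C0 gC t; rewrite le_eqVlt => /orP[/eqP<-//|t0].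
have it s n : 0 < s -> g (n%:R * s) <= g 0 + n%:R * (C * s ^+ 2).
  move=> s0; elim: n => [|n IH]; first by rewrite !mul0r addr0.
  have -> : n.+1%:R * s = n%:R * s + s by rewrite -natr1; ring.
  have := gC (n%:R * s) s (mulr_ge0 (ler0n _ _) (ltW s0)) s0.
  rewrite -natr1 mulrDl; lra.
apply/ler_addgt0Pr => e e0; have [n nP] := div_small (C * t ^+ 2) e0.
have n0 : 0 < n.+1%:R :> R by rewrite ltr0Sn.
have := it (t / n.+1%:R) n.+1 (divr_gt0 t0 n0).
have -> : n.+1%:R * (t / n.+1%:R) = t by field; rewrite gt_eqF.
have -> : n.+1%:R * (C * (t / n.+1%:R) ^+ 2) = C * t ^+ 2 / n.+1%:R.
  by field; rewrite gt_eqF.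
by move: nP; set z := C * t ^+ 2 / n.+1%:R; lra.
Qed.

(** * The zero-sum dynamics in abstract coordinates *)

Section Game.
Variables (R : realType) (J1 J2 : finType) (w1 : J1 -> R) (w2 : J2 -> R).
Hypothesis w1_ge1 : forall b, 1 <= w1 b.
Hypothesis w2_ge1 : forall b, 1 <= w2 b.
Variables (D1 : set (J1 -> R)) (h1 : (J1 -> R) -> R) (k1 : R) (q1 : (J1 -> R) -> J1 -> R).
Variables (D2 : set (J2 -> R)) (h2 : (J2 -> R) -> R) (k2 : R) (q2 : (J2 -> R) -> J2 -> R).
Hypothesis k1_gt0 : 0 < k1.
Hypothesis k2_gt0 : 0 < k2.
Hypothesis q1P : forall y, strong_argmax w1 D1 h1 k1 y (q1 y).
Hypothesis q2P : forall y, strong_argmax w2 D2 h2 k2 y (q2 y).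
Hypothesis D1bd : forall a b, D1 a -> `|a b| <= 1.
Hypothesis D2bd : forall a b, D2 a -> `|a b| <= 1.
Variables (one1 : J1 -> R) (o1 : J1) (xs1 : J1 -> R).
Variables (one2 : J2 -> R) (o2 : J2) (xs2 : J2 -> R).
Hypothesis one1_o : one1 o1 = 1.
Hypothesis one2_o : one2 o2 = 1.
Hypothesis D1_one : forall x, D1 x -> wdot w1 one1 x = 1.
Hypothesis D2_one : forall x, D2 x -> wdot w2 one2 x = 1.
Hypothesis Dxs1 : D1 xs1.
Hypothesis Dxs2 : D2 xs2.
Hypothesis xs1_interior : forall e, wdot w1 one1 e = 0 ->
  exists2 r : R, 0 < r & D1 (fun b => r * e b + xs1 b).
Hypothesis xs2_interior : forall e, wdot w2 one2 e = 0 ->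
  exists2 r : R, 0 < r & D2 (fun b => r * e b + xs2 b).
Variables (m1 : J1 -> J2 -> R) (m2 : J2 -> J1 -> R).
Hypothesis zero_sum : forall x1 x2, D1 x1 -> D2 x2 -> bil m1 x1 x2 = - bil m2 x2 x1.
Hypothesis nash1 : forall x1, D1 x1 -> bil m1 x1 xs2 <= bil m1 xs1 xs2.
Hypothesis nash2 : forall x2, D2 x2 -> bil m2 x2 xs1 <= bil m2 xs2 xs1.

Local Notation J := (J1 + J2)%type.
Implicit Types (z : J -> R) (t s : R).

Definition lpart z : J1 -> R := fun b => z (inl b).
Definition rpart z : J2 -> R := fun b => z (inr b).

Definition ftql_field z : J -> R := fun i => match i with
  | inl b => grad w1 m1 (q2 (rpart z)) b
  | inr b => grad w2 m2 (q1 (lpart z)) b end.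

Definition reduced_field z : J -> R := fun i => match i with
  | inl b => rgrad w1 m1 one1 o1 (q2 (rpart z)) b
  | inr b => rgrad w2 m2 one2 o2 (q1 (lpart z)) b end.

Local Notation N1 := (rnorm w1 m1 one1 o1).
Local Notation N2 := (rnorm w2 m2 one2 o2).
Local Notation Lq1 := ((\sum_b w1 b) / k1).
Local Notation Lq2 := ((\sum_b w2 b) / k2).

Let M := N1 + N2.
Let Lq := Lq1 + Lq2.
Let L := M * Lq.

Let N1_ge0 : 0 <= N1. Proof. exact: rnorm_ge0. Qed.
Let N2_ge0 : 0 <= N2. Proof. exact: rnorm_ge0. Qed.
Let M_ge0 : 0 <= M. Proof. exact: addr_ge0. Qed.
Let Lq1_ge0 : 0 <= Lq1.
Proof. by rewrite divr_ge0 ?(ltW k1_gt0) // sumr_ge0 // => b _; apply: le_trans (w1_ge1 b). Qed.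
Let Lq2_ge0 : 0 <= Lq2.
Proof. by rewrite divr_ge0 ?(ltW k2_gt0) // sumr_ge0 // => b _; apply: le_trans (w2_ge1 b). Qed.
Let Lq_ge0 : 0 <= Lq. Proof. exact: addr_ge0. Qed.
Let L_ge0 : 0 <= L. Proof. exact: mulr_ge0. Qed.

Lemma q1_lip y y' (e : R) : 0 <= e -> close e y y' -> close (Lq * e) (q1 y) (q1 y').
Proof.
move=> e0 c; apply: close_le (strong_argmax_lip w1_ge1 k1_gt0 (q1P y) (q1P y') c).
by rewrite ler_wpM2r // lerDl.
Qed.

Lemma q2_lip y y' (e : R) : 0 <= e -> close e y y' -> close (Lq * e) (q2 y) (q2 y').
Proof.
move=> e0 c; apply: close_le (strong_argmax_lip w2_ge1 k2_gt0 (q2P y) (q2P y') c).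
by rewrite ler_wpM2r // lerDr.
Qed.

Lemma reduced_field_lip z z' (e : R) : close e z z' ->
  close (L * e) (reduced_field z) (reduced_field z').
Proof.
move=> c i; have e0 : 0 <= e by apply: le_trans (c i).
rewrite /L -mulrA; case: i => b /=; rewrite rgradB.
  apply: le_trans (rgrad_le _ _ _ _ _ (e := Lq * e) _ _) _; first by rewrite mulr_ge0.
    by apply: q2_lip => // k; apply: c.
  by rewrite ler_wpM2r ?mulr_ge0 // lerDl.
apply: le_trans (rgrad_le _ _ _ _ _ (e := Lq * e) _ _) _; first by rewrite mulr_ge0.
  by apply: q1_lip => // k; apply: c.
by rewrite ler_wpM2r ?mulr_ge0 // lerDr.
Qed.

Lemma reduced_field_bounded z i : `|reduced_field z i| <= M.
Proof.
case: i => b /=; rewrite -[leRHS]mulr1.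
  apply: le_trans (rgrad_le _ _ _ _ _ (e := 1) _ _) _ => // [k|].
    by apply: D2bd; case: (q2P (rpart z)).
  by rewrite ler_wpM2r // lerDl.
apply: le_trans (rgrad_le _ _ _ _ _ (e := 1) _ _) _ => // [k|].
  by apply: D1bd; case: (q1P (lpart z)).
by rewrite ler_wpM2r // lerDr.
Qed.

Let P : pred J := fun i => if i is inl _ then true else false.

Lemma reduced_field_blindl : blind reduced_field P.
Proof.
move=> z z' zz [b|//] _ /=; congr (rgrad _ _ _ _ (q2 _) _).
by apply/funext => k; apply: zz.
Qed.

Lemma reduced_field_blindr : blind reduced_field (predC P).
Proof.
move=> z z' zz [//|b] _ /=; congr (rgrad _ _ _ _ (q1 _) _).
by apply/funext => k; apply: zz.
Qed.

Definition energy z := coupling w1 h1 q1 xs1 (lpart z) + coupling w2 h2 q2 xs2 (rpart z).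

(** Strategy differences are orthogonal to [one], so [rgrad] pairs like the gradient. By zero-sum
    the mutual terms of x1 and x2 cancel; what remains is the sum of the payoff changes when each
    player alone leaves the equilibrium. *)
Lemma nash_pairing z :
  wdot w1 (lpart (reduced_field z)) (diffc (q1 (lpart z)) xs1) +
  wdot w2 (rpart (reduced_field z)) (diffc (q2 (rpart z)) xs2) <= 0.
Proof.
have [Dx1 _] := q1P (lpart z); have [Dx2 _] := q2P (rpart z).
set x1 := q1 _ in Dx1 *; set x2 := q2 _ in Dx2 *.
have bilB (A B : finType) (m : A -> B -> R) a a' x :
    bil m (diffc a a') x = bil m a x - bil m a' x.
  rewrite /bil -sumrB; apply: eq_bigr => b _; rewrite -sumrB.
  by apply: eq_bigr => k _; rewrite /diffc; ring.
have -> : wdot w1 (lpart (reduced_field z)) (diffc x1 xs1) = bil m1 (diffc x1 xs1) x2.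
  by rewrite -(@rgrad_bil _ _ _ w1 m1 w1_ge1 one1 o1) // wdotBr !D1_one // subrr.
have -> : wdot w2 (rpart (reduced_field z)) (diffc x2 xs2) = bil m2 (diffc x2 xs2) x1.
  by rewrite -(@rgrad_bil _ _ _ w2 m2 w2_ge1 one2 o2) // wdotBr !D2_one // subrr.
rewrite !bilB; have := nash1 Dx1; have := nash2 Dx2.
have := zero_sum Dx1 Dx2; have := zero_sum Dxs1 Dx2; have := zero_sum Dx1 Dxs2.
have := zero_sum Dxs1 Dxs2; lra.
Qed.

Lemma wdot_perturb (A : finType) (w : A -> R) (u v x : A -> R) s (e : R) :
  (forall b, 1 <= w b) -> (forall b, `|u b - s * v b| <= e) -> (forall b, `|x b| <= 2) ->
  wdot w u x <= s * wdot w v x + (\sum_b w b) * (2 * e).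
Proof.
move=> w_ge1 uv x2; rewrite /wdot mulr_sumr mulr_suml -big_split; apply: ler_sum => b _ /=.
have wb : 0 <= w b by apply: le_trans (w_ge1 b).
have -> : w b * u b * x b = s * (w b * v b * x b) + w b * ((u b - s * v b) * x b) by ring.
rewrite lerD2l ler_wpM2l //; apply: le_trans (ler_norm _) _.
by rewrite normrM mulrC ler_pM.
Qed.

(** [coupling_diff] puts the strategies at time t + s, so the Euler estimate is used with the slope
    at that time too; [nash_pairing] there leaves only an O(s^2) increase. *)
Lemma energy_nonincreasing w : solution reduced_field w ->
  forall t, 0 <= t -> energy (w t) <= energy (w 0).
Proof.
move=> sw; pose C := ((\sum_b w1 b) + \sum_b w2 b) * (2 * (L * M)).
have W1 : 0 <= \sum_b w1 b by apply: sumr_ge0 => b _; apply: le_trans (w1_ge1 b).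
have W2 : 0 <= \sum_b w2 b by apply: sumr_ge0 => b _; apply: le_trans (w2_ge1 b).
have C0 : 0 <= C by rewrite !mulr_ge0 // addr_ge0.
apply: (nonincreasing_of_quadratic C0) => t s t0 s0.
have ts : t <= t + s <= t + s by rewrite lerDl ltW //=.
have eul i := solution_euler M_ge0 reduced_field_lip reduced_field_bounded i sw t0 s0 ts.
have b1 : forall b, `|diffc (q1 (lpart (w (t + s)))) xs1 b| <= 2.
  move=> b; apply: le_trans (ler_normB _ _) _; rewrite mulr2n lerD //; apply: D1bd => //.
  by case: (q1P (lpart (w (t + s)))).
have b2 : forall b, `|diffc (q2 (rpart (w (t + s)))) xs2 b| <= 2.
  move=> b; apply: le_trans (ler_normB _ _) _; rewrite mulr2n lerD //; apply: D2bd => //.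
  by case: (q2P (rpart (w (t + s)))).
have p1 := wdot_perturb w1_ge1 (u := diffc (lpart (w (t + s))) (lpart (w t)))
  (v := lpart (reduced_field (w (t + s)))) (fun b => eul (inl b)) b1.
have p2 := wdot_perturb w2_ge1 (u := diffc (rpart (w (t + s))) (rpart (w t)))
  (v := rpart (reduced_field (w (t + s)))) (fun b => eul (inr b)) b2.
have c1 := coupling_diff w1_ge1 k1_gt0 q1P xs1 (lpart (w t)) (lpart (w (t + s))).
have c2 := coupling_diff w2_ge1 k2_gt0 q2P xs2 (rpart (w t)) (rpart (w (t + s))).
have := ler_wpM2l (ltW s0) (nash_pairing (w (t + s))).
rewrite mulr0 mulrDr /energy /C => np.
have -> : ((\sum_b w1 b) + \sum_b w2 b) * (2 * (L * M)) * s ^+ 2 =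
  (\sum_b w1 b) * (2 * (L * M * s ^+ 2)) + (\sum_b w2 b) * (2 * (L * M * s ^+ 2)) by ring.
move: np (le_trans c1 p1) (le_trans c2 p2); lra.
Qed.

Lemma solution_frozen w i : solution reduced_field w -> (forall z, reduced_field z i = 0) ->
  forall t, 0 <= t -> w t i = w 0 i.
Proof.
move=> sw fi t; rewrite le_eqVlt => /orP[/eqP<-//|t0].
have [r _] := solution_mvt i sw (lexx 0) t0.
by rewrite add0r fi mul0r => /eqP; rewrite subr_eq0 => /eqP.
Qed.

(** Each coupling is bounded above because the energy is and the other coupling is bounded below;
    coercivity applies since the coordinates [o1] and [o2] are frozen. *)
Lemma reduced_bounded w : solution reduced_field w ->
  exists C : R, forall t i, 0 <= t -> `|w t i| <= C.
Proof.
move=> sw; have low1 := coupling_low w1_ge1 k1_gt0 q1P Dxs1.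
have low2 := coupling_low w2_ge1 k2_gt0 q2P Dxs2.
have [C1 C1P] := coupling_coercive w1_ge1 k1_gt0 q1P one1_o xs1_interior
  (energy (w 0) + h2 xs2) (w 0 (inl o1)).
have [C2 C2P] := coupling_coercive w2_ge1 k2_gt0 q2P one2_o xs2_interior
  (energy (w 0) + h1 xs1) (w 0 (inr o2)).
exists (`|C1| + `|C2|) => t i t0; have en := energy_nonincreasing sw t0.
have f1 : w t (inl o1) = w 0 (inl o1).
  by apply: solution_frozen => // z /=; apply: rgrad_o.
have f2 : w t (inr o2) = w 0 (inr o2).
  by apply: solution_frozen => // z /=; apply: rgrad_o.
have e1 : coupling w1 h1 q1 xs1 (lpart (w t)) <= energy (w 0) + h2 xs2.
  by have := low2 (rpart (w t)); move: en; rewrite {1}/energy; lra.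
have e2 : coupling w2 h2 q2 xs2 (rpart (w t)) <= energy (w 0) + h1 xs1.
  by have := low1 (lpart (w t)); move: en; rewrite {1}/energy; lra.
case: i => b.
  apply: le_trans (C1P _ e1 f1 b) _; apply: le_trans (ler_norm _) _; by rewrite lerDl.
apply: le_trans (C2P _ e2 f2 b) _; apply: le_trans (ler_norm _) _; by rewrite lerDr.
Qed.

Definition reduce (w : R -> J -> R) t : J -> R := fun i => match i with
  | inl b => w t (inl b) - one1 b * (w t (inl o1) - w 0 (inl o1))
  | inr b => w t (inr b) - one2 b * (w t (inr o2) - w 0 (inr o2)) end.

Lemma reduce0 w : reduce w 0 = w 0.
Proof. by apply/funext => -[b|b]; rewrite /reduce subrr mulr0 subr0. Qed.

Lemma q1_reduce w t : q1 (lpart (reduce w t)) = q1 (lpart (w t)).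
Proof.
rewrite -(mirror_shift w1_ge1 k1_gt0 q1P D1_one _ (w t (inl o1) - w 0 (inl o1))).
congr q1; apply/funext => b; rewrite /lpart /=; ring.
Qed.

Lemma q2_reduce w t : q2 (rpart (reduce w t)) = q2 (rpart (w t)).
Proof.
rewrite -(mirror_shift w2_ge1 k2_gt0 q2P D2_one _ (w t (inr o2) - w 0 (inr o2))).
congr q2; apply/funext => b; rewrite /rpart /=; ring.
Qed.

Lemma solution_reduce w : solution ftql_field w -> solution reduced_field (reduce w).
Proof.
move=> [cw dw]; split.
  by case=> b t /=; (apply: cvgB; first exact: cw);
    apply: cvgMr; (apply: cvgB; first exact: cw); exact: cvg_cst.
move=> t t0; case=> b /=; rewrite ?q1_reduce ?q2_reduce /rgrad.
  have d1 := dw t t0 (inl b); have d2 := dw t t0 (inl o1).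
  by apply: is_derive_eq; rewrite /= subr0.
have d1 := dw t t0 (inr b); have d2 := dw t t0 (inr o2).
by apply: is_derive_eq; rewrite /= subr0.
Qed.

Definition recurrent_strategies w := exists t : nat -> R,
  [/\ forall n, t n < t n.+1, t @ \oo --> +oo,
      forall b, q1 (lpart (w (t n))) b @[n --> \oo] --> q1 (lpart (w 0)) b &
      forall b, q2 (rpart (w (t n))) b @[n --> \oo] --> q2 (rpart (w 0)) b].

(** Returns of the reduced orbit pass to the strategies through the Lipschitz mirror maps, which do
    not distinguish [reduce w] from [w]. *)
Lemma close_recurrent w :
  (forall e : R, 0 < e -> forall N, exists2 n, (N <= n)%N & close e (reduce w n%:R) (w 0)) ->
  recurrent_strategies w.
Proof.
move=> rec.
have : forall k : nat, exists n, (k <= n)%N /\ close (k.+1%:R^-1) (reduce w n%:R) (w 0).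
  move=> k; have k0 : 0 < k.+1%:R^-1 :> R by rewrite invr_gt0.
  by have [n kn c] := rec _ k0 k; exists n.
move=> /choice[nu nuP].
(* Asking for a return no earlier than [(tau k').+1] makes the times strictly increasing and the
   distances tend to 0. *)
pose fix tau k : nat := if k is k'.+1 then nu (tau k').+1 else nu 0%N.
have tauS k : (tau k < tau k.+1)%N by have [] := nuP (tau k).+1.
have tau_ge k : (k <= tau k)%N.
  by elim: k => // k IH; apply: leq_ltn_trans (tauS k).
have tau_close k : close (k.+1%:R^-1) (reduce w (tau k)%:R) (w 0).
  case: k => [|k] /=; first by have [] := nuP 0%N.
  have [_] := nuP (tau k).+1; apply: close_le.
  by rewrite lef_pV2 ?posrE ?ltr0Sn // ler_nat !ltnS.
have lim (K : finType) (u : nat -> K -> R) (v : K -> R) :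
    (forall k, close (Lq * k.+1%:R^-1) (u k) v) -> forall b, u n b @[n --> \oo] --> v b.
  move=> uv b; apply/cvgrPdist_lt => e e0.
  have Lq1 : 0 < Lq + 1 by rewrite ltr_wpDl.
  have eL : 0 < e / (Lq + 1) by rewrite divr_gt0.
  have near_e := near_infty_natSinv_lt (PosNum eL).
  near=> k; rewrite distrC; apply: le_lt_trans (uv k b) _.
  have : k.+1%:R^-1 < e / (Lq + 1) by near: k; exact: near_e.
  rewrite ltr_pdivlMr // => H; apply: le_lt_trans H; rewrite mulrC ler_wpM2l //.
  by rewrite lerDl.
exists (fun k => (tau k)%:R); split.
- by move=> n; rewrite ltr_nat.
- apply/cvgryPge => A; have [n An] := nat_large A; exists n => // k /= nk.
  by apply: le_trans An _; rewrite ler_nat (leq_trans nk).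
- move=> b; apply: (lim _ (fun k => q1 (lpart (w (tau k)%:R)))) => k.
  rewrite -q1_reduce; apply: q1_lip; first by rewrite invr_ge0.
  by move=> b'; apply: tau_close.
- move=> b; apply: (lim _ (fun k => q2 (rpart (w (tau k)%:R)))) => k.
  rewrite -q2_reduce; apply: q2_lip; first by rewrite invr_ge0.
  by move=> b'; apply: tau_close.
Unshelve. all: by end_near.
Qed.

Theorem lebesgue_null_nonrecurrent_strategies : lebesgue_null
  [set z | exists w, [/\ solution ftql_field w, w 0 = z & ~ recurrent_strategies w]].
Proof.
have := lebesgue_null_nonrecurrent L_ge0 M_ge0 reduced_field_lip reduced_field_bounded
  reduced_field_blindl reduced_field_blindr (inl o1).
apply: lebesgue_null_sub => z [w [sw w0 nr]]; exists (reduce w).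
have sr := solution_reduce sw; split => //; first by rewrite reduce0.
  by have [C CP] := reduced_bounded sr; exists C => n i; apply: CP.
apply: contrapT => nn; apply: nr; apply: close_recurrent => e e0 N.
apply: contrapT => nc; apply: nn; exists e => //; exists N => n Nn c.
by apply: nc; exists n => //; rewrite w0.
Qed.

End Game.

(** * Mirror maps, gradients and trajectories in real coordinates *)

Section Encoding.
Variables (R : realType) (d : nat).
Local Notation C := R[i].
Local Notation J := ('I_d * 'I_d)%type.
Local Notation hoc := (@herm_of_coords R d).
Local Notation dot := (wdot (@wt R d)).

Definition unit_coords (b : J) : R := (b.1 == b.2)%:R.

Lemma dot_unit_coords x : dot unit_coords x = \sum_i x (i, i).
Proof.
have -> : dot unit_coords x = \sum_i \sum_j wt R (i, j) * (i == j)%:R * x (i, j).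
  by rewrite pair_bigA; apply: eq_bigr => -[].
apply: eq_bigr => i _; rewrite (bigD1 i) //= big1 => [|j ij].
  by rewrite /wt /= eqxx !mul1r addr0.
by rewrite eq_sym (negbTE ij) mulr0 mul0r.
Qed.

Lemma ipC (A B : 'M[C]_d) : ip A B = ip B A.
Proof. by rewrite /ip mxtrace_mulC. Qed.

(** Density matrices are Hermitian, so their pairing sees only the Hermitian part of [Y]. *)
Lemma mirror_coords theta (Y : 'M[C]_d) :
  mirror theta (hoc (coords Y)) = mirror theta Y.
Proof.
have E X : density X -> complex.Re (\tr (hoc (coords Y) *m X)) = complex.Re (\tr (Y *m X)).
  move=> [[hX _] _]; rewrite -!/(ip _ _) ![ip _ X]ipC !ip_dot //.
  by rewrite herm_of_coordsK.
rewrite /mirror; congr xget; apply/seteqP; split=> X [dX mX]; split => // X' dX'.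
  by rewrite -!E //; apply: mX.
by rewrite !E //; apply: mX.
Qed.

Lemma coords_cont (Y : R -> 'M[C]_d) A b : mx_cont_on Y A ->
  {within A, continuous (fun t => coords (Y t) b)}.
Proof.
move=> cY; rewrite /coords; case: (b.1 == b.2) => t; first by have [] := cY b.1 b.1.
case: (b.1 < b.2)%N; apply: cvgMl.
  by apply: cvgD; [have [c _] := cY b.1 b.2|have [c _] := cY b.2 b.1]; exact: c.
by apply: cvgB; [have [_ c] := cY b.2 b.1|have [_ c] := cY b.1 b.2]; exact: c.
Qed.

Lemma coords_derive (Y : R -> 'M[C]_d) t D b : mx_is_derive Y t D ->
  is_derive t 1 (fun s => coords (Y s) b) (coords D b).
Proof.
move=> dY; rewrite /coords; case: (b.1 == b.2); first by have [] := dY b.1 b.1.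
have [r1 i1] := dY b.1 b.2; have [r2 i2] := dY b.2 b.1.
case: (b.1 < b.2)%N; apply: is_derive_eq.
  rewrite /GRing.scale /=; ring.
rewrite /GRing.scale /=; ring.
Qed.

Lemma herm_of_coords_cvg (s : nat -> J -> R) a :
  (forall b, s n b @[n --> \oo] --> a b) -> mx_cvg (fun n => hoc (s n)) (hoc a).
Proof.
move=> sa i j; split.
  rewrite mxE; under eq_fun do rewrite mxE.
  case: eqP => _ /=; first exact: sa.
  by case: ifP => _; exact: sa.
rewrite mxE; under eq_fun do rewrite mxE.
case: eqP => _ /=; first exact: cvg_cst.
by case: ifP => _ /=; [exact: sa|apply: cvgN; exact: sa].
Qed.

(** The matrix with coordinates [grad] witnesses that the [xget] is not a default value; testing on
    the coordinate basis shows it is the only candidate. *)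
Lemma grad_coords (K : finType) (m : J -> K -> R) (phi : 'M[C]_d -> R) x :
  (forall a, phi (hoc a) = bil m a x) ->
  coords (xget 0 [set M | Defs.hermitian M /\
    forall A, Defs.hermitian A -> phi A = complex.Re (\tr (A *m M))]) =
  grad (@wt R d) m x.
Proof.
move=> phiE; set S := [set M | _].
have w1 := @wt_ge1 R d.
have wn0 b : @wt R d b != 0 by rewrite gt_eqF // (lt_le_trans _ (w1 b)).
have [hM MP] : S (xget 0 S).
  apply: xgetPex; exists (hoc (grad (@wt R d) m x)); split; first exact: hermitian_coords.
  move=> A hA; rewrite -{1}(coordsK hA) phiE -/(ip _ _) ip_dot // herm_of_coordsK.
  by rewrite wdotC wdot_grad.
have dlt_dot c b : dot (dlt R b) c = wt R b * c b.
  rewrite /wdot (bigD1 b) //= big1 => [|b' /negbTE bb].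
    by rewrite /dlt eqxx mulr1 addr0.
  by rewrite /dlt bb mulr0 mul0r.
apply/funext => b; have := MP _ (hermitian_coords (dlt R b)).
rewrite phiE -/(ip _ _) ip_dot; last exact: hermitian_coords.
rewrite herm_of_coordsK -(wdot_grad m w1) wdotC !dlt_dot.
by move=> /(mulfI (wn0 b)).
Qed.

End Encoding.

(** * Payoffs as bilinear forms in coordinates *)

Section Payoff.
Variables (R : realType) (d1 d2 : nat) (Om : finType).
Variables (P : Om -> 'M[R[i]]_(d1 * d2)) (U : Om -> R).

Lemma payoff_linl X2 : lin_fun (fun a => payoff U P (@herm_of_coords R d1 a) X2).
Proof.
move=> k a c; rewrite /payoff mulr_sumr -big_split; apply: eq_bigr => o _ /=.
have -> : herm_of_coords (fun b => k * a b + c b) *t X2 =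
    k%:C%C *: (herm_of_coords a *t X2) + herm_of_coords c *t X2.
  by apply/matrixP => i j; rewrite herm_of_coords_lin !mxE; ring.
by rewrite mulmxDr mxtraceD ReD -scalemxAr mxtraceZ ReZ mulrDr mulrCA.
Qed.

Lemma payoff_linr X1 : lin_fun (fun a => payoff U P X1 (@herm_of_coords R d2 a)).
Proof.
move=> k a c; rewrite /payoff mulr_sumr -big_split; apply: eq_bigr => o _ /=.
have -> : X1 *t herm_of_coords (fun b => k * a b + c b) =
    k%:C%C *: (X1 *t herm_of_coords a) + X1 *t herm_of_coords c.
  by apply/matrixP => i j; rewrite herm_of_coords_lin !mxE; ring.
by rewrite mulmxDr mxtraceD ReD -scalemxAr mxtraceZ ReZ mulrDr mulrCA.
Qed.

Definition payoff_mx b k :=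
  payoff U P (herm_of_coords (dlt R b)) (herm_of_coords (dlt R k)).

Lemma payoff_bil a x :
  payoff U P (herm_of_coords a) (herm_of_coords x) = bil payoff_mx a x.
Proof.
rewrite (lin_fun_sum (payoff_linl _)); apply: eq_bigr => b _.
rewrite (lin_fun_sum (payoff_linr _)) mulr_sumr; apply: eq_bigr => k _.
rewrite /payoff_mx; ring.
Qed.

Lemma payoff_bilC a x :
  payoff U P (herm_of_coords a) (herm_of_coords x) = bil (fun k b => payoff_mx b k) x a.
Proof.
rewrite payoff_bil /bil exchange_big /=; apply: eq_bigr => k _.
by apply: eq_bigr => b _; ring.
Qed.

End Payoff.

Theorem theorem3 (R : realType) (d1 d2 : nat) (Om : finType)
  (P : Om -> 'M[R[i]]_(d1 * d2)) (U1 U2 : Om -> R)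
  (theta1 theta2 : R -> R)
  (X1s : 'M[R[i]]_d1) (X2s : 'M[R[i]]_d2) :
  (0 < d1)%N -> (0 < d2)%N ->
  (forall w, psd (P w)) -> \sum_(w : Om) P w = 1%:M ->
  admissible_theta theta1 -> admissible_theta theta2 ->
  (* zero-sum: u_1 = - u_2 *)
  (forall (X1 : 'M[R[i]]_d1) (X2 : 'M[R[i]]_d2), density X1 -> density X2 ->
     payoff U1 P X1 X2 = - payoff U2 P X1 X2) ->
  (* full-rank Nash equilibrium *)
  nash2 U1 U2 P X1s X2s -> pdef X1s -> pdef X2s ->
  (* for Lebesgue-a.e. Y(0) in H^d1 x H^d2, the FTQL trajectory is recurrent *)
  lebesgue_null
    [set z : ('I_d1 * 'I_d1 + 'I_d2 * 'I_d2)%type -> R |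
       exists (Y1 : R -> 'M[R[i]]_d1) (Y2 : R -> 'M[R[i]]_d2),
         [/\ ftql_sol U1 U2 P theta1 theta2 Y1 Y2,
             Y1 0 = herm_of_coords (fun ij => z (inl ij)),
             Y2 0 = herm_of_coords (fun ij => z (inr ij)) &
             ~ poincare_recurrent (fun t => mirror theta1 (Y1 t))
                                  (fun t => mirror theta2 (Y2 t))]].
Proof.
move=> d1_gt0 d2_gt0 _ _ adm1 adm2 zs [dX1 dX2 n1 n2] pX1 pX2.
have [k1 k1_gt0 m1P] := mirrorP d1_gt0 adm1; have q1P y := proj1 (m1P y).
have [k2 k2_gt0 m2P] := mirrorP d2_gt0 adm2; have q2P y := proj1 (m2P y).
have X1E : herm_of_coords (coords X1s) = X1s by apply: coordsK; case: pX1.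
have X2E : herm_of_coords (coords X2s) = X2s by apply: coordsK; case: pX2.
have mir1 (Y : 'M[R[i]]_d1) : mirror theta1 Y = herm_of_coords (mirrorc theta1 (coords Y)).
  by rewrite (proj2 (m1P _)) mirror_coords.
have mir2 (Y : 'M[R[i]]_d2) : mirror theta2 Y = herm_of_coords (mirrorc theta2 (coords Y)).
  by rewrite (proj2 (m2P _)) mirror_coords.
pose o1 : 'I_d1 := Ordinal d1_gt0; pose o2 : 'I_d2 := Ordinal d2_gt0.
(* [M2] is transposed so that each player's own variable comes first in [bil]. *)
pose M1 := payoff_mx P U1; pose M2 k b := payoff_mx P U2 b k.
have one_dens d x : densc x -> wdot (@wt R d) (@unit_coords R d) x = 1.
  by move=> /densc_iff[_]; rewrite dot_unit_coords.
have int1 e : wdot (@wt R d1) (@unit_coords R d1) e = 0 ->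
    exists2 r : R, 0 < r & densc (fun b => r * e b + coords X1s b).
  by rewrite dot_unit_coords; apply: dens_interior.
have int2 e : wdot (@wt R d2) (@unit_coords R d2) e = 0 ->
    exists2 r : R, 0 < r & densc (fun b => r * e b + coords X2s b).
  by rewrite dot_unit_coords; apply: dens_interior.
have zs' x1 x2 : densc x1 -> densc x2 -> bil M1 x1 x2 = - bil M2 x2 x1.
  by move=> D1 D2; rewrite -payoff_bil -payoff_bilC; apply: zs.
have n1' x1 : densc x1 -> bil M1 x1 (coords X2s) <= bil M1 (coords X1s) (coords X2s).
  by move=> D1; rewrite -!payoff_bil X1E X2E; apply: n1.
have n2' x2 : densc x2 -> bil M2 x2 (coords X1s) <= bil M2 (coords X2s) (coords X1s).
  by move=> D2; rewrite -!payoff_bilC X1E X2E; apply: n2.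
have dx1 : densc (coords X1s) by rewrite /densc X1E.
have dx2 : densc (coords X2s) by rewrite /densc X2E.
have u1 : @unit_coords R d1 (o1, o1) = 1 by rewrite /unit_coords eqxx.
have u2 : @unit_coords R d2 (o2, o2) = 1 by rewrite /unit_coords eqxx.
have := @lebesgue_null_nonrecurrent_strategies R _ _ _ _ (@wt_ge1 R d1) (@wt_ge1 R d2)
  _ _ _ _ _ _ _ _ k1_gt0 k2_gt0 q1P q2P (@dens_bound R d1) (@dens_bound R d2)
  _ _ _ _ _ _ u1 u2 (@one_dens d1) (@one_dens d2) dx1 dx2 int1 int2 M1 M2 zs' n1' n2'.
apply: lebesgue_null_sub => z [Y1 [Y2 [[c1 c2 dY] Y10 Y20 nr]]].
(* Only the Hermitian parts of [Y1] and [Y2] are kept; by [mirror_coords] they determine the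
   strategies. *)
exists (fun t i => match i with inl b => coords (Y1 t) b | inr b => coords (Y2 t) b end).
split.
- split; first by case=> b; apply: coords_cont.
  move=> t t0; have [e1 e2] := dY t t0; case=> b.
    rewrite /ftql_field /= -(@grad_coords _ _ _ M1 (fun A => payoff U1 P A (mirror theta2 (Y2 t)))).
      exact: coords_derive e1.
    by move=> a; rewrite mir2 payoff_bil.
  rewrite /ftql_field /= -(@grad_coords _ _ _ M2 (fun A => payoff U2 P (mirror theta1 (Y1 t)) A)).
    exact: coords_derive e2.
  by move=> a; rewrite mir1 payoff_bilC.
- by apply/funext => -[b|b]; rewrite ?Y10 ?Y20 herm_of_coordsK.
- move=> [t [ti tinf t1 t2]]; apply: nr; exists t; split => //.
    rewrite mir1; under [X in mx_cvg X]eq_fun do rewrite mir1.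
    exact: herm_of_coords_cvg t1.
  rewrite mir2; under [X in mx_cvg X]eq_fun do rewrite mir2.
  exact: herm_of_coords_cvg t2.
Qed.
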